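(* For all real numbers $X,Y$ with $\frac32\le X\le Y$ one has $$ M(X,Y)=2(33-\pi^2)\frac{\zeta(2)}{\zeta(3)}(XY)^2+O\big(XY^2(\log X)\log Y\big), $$ with an absolute implied constant.
   Context: For $\mathbf{x}=(x_0,x_1,x_2)\in\mathbb{Z}^3$ write $|\mathbf{x}|=\max(|x_0|,|x_1|,|x_2|)$. $M(X,Y)$ denotes the number of pairs $\mathbf{x}=(x_0,x_1,x_2)$, $\mathbf{y}=(y_0,y_1,y_2)$ in $(\mathbb{Z}\setminus\{0\})^3$ (all six coordinates non-zero) with $x_0y_0+x_1y_1+x_2y_2=0$, $|\mathbf{x}|\le X$ and $|\mathbf{y}|\le Y$. $\zeta$ is the Riemann zeta function. *)

(* Defs.v *)
From mathcomp Require Import all_boot all_order all_algebra finmap.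
From mathcomp Require Import all_classical all_reals all_analysis.
From mathcomp Require Import zify.

Set Implicit Arguments.
Unset Strict Implicit.
Unset Printing Implicit Defensive.

Import Order.TTheory GRing.Theory Num.Theory.
Import numFieldNormedType.Exports.

Local Open Scope classical_set_scope.
Local Open Scope ring_scope.

(* Only meaningful for 1 < s; for s <= 1 the series diverges and the value is
   irrelevant. *)
Definition zeta {R : realType} (s : R) : R := limn (series (riemannR s)).

Definition supnorm (x : 'rV[int]_3) : int := \big[Num.max/0]_(i < 3) `|x 0 i|.

Definition Mset {R : realType} (X Y : R) : set ('rV[int]_3 * 'rV[int]_3) :=
  [set p : 'rV[int]_3 * 'rV[int]_3 | let: (x, y) := p in
    [/\ forall i, x 0 i != 0,
        forall i, y 0 i != 0,
        \sum_(i < 3) x 0 i * y 0 i = 0,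
        (supnorm x)%:~R <= X
      & (supnorm y)%:~R <= Y]].

(* [fset_set] is the empty set on infinite arguments; [finite_Mset] below shows
   that this case does not occur. *)
Definition M {R : realType} (X Y : R) : nat := #|` fset_set (Mset X Y)|.

Lemma supnormE (x : 'rV[int]_3) :
  supnorm x = Num.max `|x 0 0| (Num.max `|x 0 1| `|x 0 2|).
Proof.
rewrite /supnorm !big_ord_recl big_ord0 (max_l (normr_ge0 _)).
by congr (Num.max `|x 0 _| (Num.max `|x 0 _| `|x 0 _|)); apply/val_inj.
Qed.

Lemma ler_supnorm (x : 'rV[int]_3) i : `|x 0 i| <= supnorm x.
Proof. exact: (le_bigmax _ (fun i => `|x 0 i|)). Qed.

Lemma finite_supnorm_le {R : realType} (X : R) :
  finite_set [set x : 'rV[int]_3 | (supnorm x)%:~R <= X].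
Proof.
pose N := Num.truncn X.
pose f (g : {ffun 'I_3 -> 'I_(N + N).+1}) : 'rV[int]_3 :=
  \row_i ((g i : nat)%:Z - N%:Z).
apply: (@sub_finite_set _ _ (f @` setT)); last exact: finite_image.
move=> x /= xX.
have X0 : 0 <= X by apply: le_trans xX; rewrite ler0z (le_trans _ (ler_supnorm x 0)).
have xN (i : 'I_3) : (absz (x 0%R i) <= N)%N.
  rewrite truncn_ge_nat//; apply: le_trans xX.
  by rewrite -[_%:R]/((absz (x 0 i))%:Z%:~R) ler_int abszE ler_supnorm.
have xP (i : 'I_3) : x 0 i + N%:Z = absz (x 0 i + N%:Z).
  by move: (xN i); lia.
exists [ffun i => inord (absz (x 0 i + N%:Z))] => //.
apply/rowP => i; rewrite !mxE ffunE inordK; first by rewrite -xP addrK.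
by move: (xN i); lia.
Qed.

Lemma finite_Mset {R : realType} (X Y : R) : finite_set (Mset X Y).
Proof.
apply: sub_finite_set (finite_setX (finite_supnorm_le X) (finite_supnorm_le Y)).
by move=> [x y] [].
Qed.

(* Main.v *)
Require Import Defs.
From mathcomp Require Import all_boot all_order all_algebra all_solvable finmap.
From mathcomp Require Import all_classical all_reals all_analysis.
From mathcomp Require Import zify ring lra.

Import Order.TTheory GRing.Theory Num.Theory.
Import numFieldNormedType.Exports.

Set Implicit Arguments.
Unset Strict Implicit.
Unset Printing Implicit Defensive.

Local Open Scope classical_set_scope.
Local Open Scope ring_scope.

(** The count is a circle-method computation carried out on a finite cyclic group, so
    that only finite sums of cosines occur.

    Let n and m be the integer parts of X and Y, and let P be a common multiple of
    1, ..., n larger than every value of x0 y0 + x1 y1 + x2 y2.  Averaging over the P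
    frequencies a/P detects the vanishing of that form exactly, and the count becomes
    the average of (2 (T(a) - n))^3, where T(a) is the sum over x <= n of the Dirichlet
    kernel D_m at x a/P ([expsum]; the shift by n removes y = 0).

    Dilating a Dirichlet kernel by x equals averaging the longer kernel D_(xm) over the
    translates by the fractions b/x ([dirichlet_dilate]).  This writes T as an exact sum,
    over all fractions c/P with denominator at most n, of translates of the functions
    arcsum c, each concentrated at 0 ([expsum_arcsum]).  By Dirichlet approximation every
    frequency has one fraction such that all the others together contribute at most
    O(n log n) ([off_arc_bound]).  A sum in which one term V dominates and the rest E is
    bounded by B satisfies |(V + E)^3 - sum of cubes| = O(B (squares)), and the average
    of the squares is O(n m log n), because it is governed by the sum of
    gcd(x, y)/max(x, y) ([sum_gcd_div_max]).  Bounding two of the three factors in mean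
    square in this way is what keeps the error at two logarithms.  The cubes of T may
    thus be replaced by the diagonal sum of the cubes of the arcsums
    ([cube_diagonal_bound], [zerocount_mainsum]).

    By orthogonality again that diagonal sum counts lattice points: it is [mainsum], the
    sum over x of gcd(x) H(x m)/(x0 x1 x2), with H(A, B, C) the number of triples
    i + j + k = 0 in the box |i| <= A, |j| <= B, |k| <= C.  For C largest,
    H = (2A+1)(2B+1) - t(t+1) with t = max(0, A + B - C) ([hexcountE]), and the sum over
    a, b <= k of max(0, a + b - k)^2/(ab) has the closed form
    k^2 (1 + 1/4 + ... + 1/k^2) - (3/2) k (k - 1) ([corner2E]).  So the sum of
    H/(x0 x1 x2) over x is asymptotic to (33/4 - (3/2) zeta(2)) times a square
    ([hexsum_asymp]).  Writing gcd as a sum of totients produces the series of phi(q)/q^3,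
    which is zeta(2)/zeta(3) ([totient_zeta]), and zeta(2) = pi^2/6 ([basel]) turns
    8 (33/4 - (3/2) zeta(2)) into 2 (33 - pi^2). *)

(** Discharges the side conditions x != 0 of [field] by proving 0 < x. *)
Ltac posne := repeat (apply/andP; split); apply: lt0r_neq0; lra.

(** * Harmonic sums and a triangular sum in closed form *)

Section FiniteSums.
Variable R : realFieldType.
Implicit Types (n m k q : nat).

Definition harm n : R := \sum_(1 <= k < n.+1) k%:R^-1.
Definition zetasum (s n : nat) : R := \sum_(1 <= k < n.+1) (k%:R ^+ s)^-1.

Lemma sum_recr1 (V : nmodType) n (F : nat -> V) :
  \sum_(1 <= k < n.+2) F k = \sum_(1 <= k < n.+1) F k + F n.+1.
Proof. by rewrite big_nat_recr. Qed.

Lemma harmS n : harm n.+1 = harm n + n.+1%:R^-1.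
Proof. exact: sum_recr1. Qed.

Lemma zetasumS s n : zetasum s n.+1 = zetasum s n + (n.+1%:R ^+ s)^-1.
Proof. exact: sum_recr1. Qed.

Lemma ler_sum1 n (F G : nat -> R) :
  (forall k, (0 < k)%N -> (k <= n)%N -> F k <= G k) ->
  \sum_(1 <= k < n.+1) F k <= \sum_(1 <= k < n.+1) G k.
Proof. by move=> FG; apply: ler_sum_nat => k /andP[k0 kn]; apply: FG. Qed.

Lemma sum_const1 n (x : R) : \sum_(1 <= k < n.+1) x = n%:R * x.
Proof. by rewrite sumr_const_nat subn1 mulr_natl. Qed.

Lemma harm_ge0 n : 0 <= harm n.
Proof. by apply: sumr_ge0 => k _; rewrite invr_ge0. Qed.

Lemma harm_homo n m : (n <= m)%N -> harm n <= harm m.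
Proof.
move=> /subnKC <-; elim: (m - n)%N => [|k IH]; first by rewrite addn0.
by rewrite addnS harmS (le_trans IH)// lerDl invr_ge0.
Qed.

Lemma harm_ge1 n : (0 < n)%N -> 1 <= harm n.
Proof. by move=> /harm_homo; rewrite {1}/harm big_nat1 invr1. Qed.

Lemma square_recr (V : nmodType) n (F : nat -> nat -> V) :
  \sum_(1 <= a < n.+2) \sum_(1 <= b < n.+2) F a b =
  \sum_(1 <= a < n.+1) \sum_(1 <= b < n.+1) F a b +
  \sum_(1 <= a < n.+1) (F a n.+1 + F n.+1 a) + F n.+1 n.+1.
Proof.
rewrite sum_recr1 sum_recr1 addrA; congr (_ + _).
under eq_bigr do rewrite sum_recr1.
by rewrite !big_split/= -!addrA.
Qed.

(** The factor (n < a + b) restricts to the corner of the square where a + b - n is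
    positive.  For p = 2 this is what a hexagon lacks compared with a parallelogram; the
    cases p = 0, 1 only serve the induction on n. *)
Definition corner_sum (p n : nat) : R :=
  \sum_(1 <= a < n.+1) \sum_(1 <= b < n.+1)
    (n < a + b)%N%:R * (a%:R + b%:R - n%:R) ^+ p / (a%:R * b%:R).

(** Partial fractions: 1/(ab) = (1/a + 1/b)/(a + b) with a + b = n + 1 constant. *)
Lemma sum_antidiag n :
  \sum_(1 <= a < n.+1) \sum_(1 <= b < n.+1)
     (a + b == n.+1)%N%:R / (a%:R * b%:R) = 2 / n.+1%:R * harm n :> R.
Proof.
have E a : (0 < a)%N -> (a <= n)%N -> \sum_(1 <= b < n.+1)
     (a + b == n.+1)%N%:R / (a%:R * b%:R) =
     n.+1%:R^-1 * (a%:R^-1 + (n.+1 - a)%:R^-1) :> R.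
  move=> a0 an; rewrite (bigD1_seq (n.+1 - a)%N) ?iota_uniq//=; last first.
    by rewrite mem_index_iota; lia.
  rewrite big1 ?addr0 => [|b /eqP bn]; last first.
    by rewrite (_ : (_ == _) = false) ?mul0r//; lia.
  rewrite subnKC ?leqW// eqxx /= natrB ?leqW//.
  have : a%:R < n.+1%:R :> R by rewrite ltr_nat.
  have : 0 < a%:R :> R by rewrite ltr0n.
  by move=> ? ?; field; posne.
under eq_big_nat => a /andP[a0 an] do rewrite E//.
rewrite -mulr_sumr big_split/= [X in _ * (_ + X)]big_nat_rev/=.
rewrite [X in _ * (_ + X)](_ : _ = harm n); last first.
  by apply: eq_big_nat => k /andP[k0 kn]; congr (_%:R^-1); lia.
by rewrite -/(harm n); ring.
Qed.

(** Passing from n to n + 1 removes the antidiagonal a + b = n + 1 and adds a row and a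
    column; both amount to 2 H_n/(n + 1) and cancel, so that only the new corner term
    1/(n + 1)^2 survives. *)
Lemma corner0E n : corner_sum 0 n = zetasum 2 n.
Proof.
elim: n => [|n IH]; first by rewrite /corner_sum/zetasum !big_geq.
rewrite zetasumS -IH {1}/corner_sum square_recr.
have -> : \sum_(1 <= a < n.+1) \sum_(1 <= b < n.+1)
   (n.+1 < a + b)%N%:R * (a%:R + b%:R - n.+1%:R) ^+ 0 / (a%:R * b%:R) =
   corner_sum 0 n - 2 / n.+1%:R * harm n.
  rewrite -sum_antidiag /corner_sum -sumrB; apply: eq_big_nat => a _.
  rewrite -sumrB; apply: eq_big_nat => b _; rewrite -mulrBl; congr (_ / _).
  by rewrite !expr0 !mulr1 [(n < _)%N]leq_eqVlt eq_sym; case: eqP => [->|_];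
     rewrite ?ltnn ?subrr ?subr0.
have -> : \sum_(1 <= a < n.+1)
   ((n.+1 < a + n.+1)%N%:R * (a%:R + n.+1%:R - n.+1%:R) ^+ 0 / (a%:R * n.+1%:R) +
    (n.+1 < n.+1 + a)%N%:R * (n.+1%:R + a%:R - n.+1%:R) ^+ 0 / (n.+1%:R * a%:R))
  = 2 / n.+1%:R * harm n.
  rewrite /harm mulr_sumr; apply: eq_big_nat => a /andP[a0 an].
  rewrite (_ : (n.+1 < a + n.+1)%N = true); last by lia.
    rewrite (_ : (n.+1 < n.+1 + a)%N = true) /=; last by lia.
  have : 0 < a%:R :> R by rewrite ltr0n.
  by move=> ?; have n0 := ler0n R n; field; posne.
rewrite (_ : (n.+1 < n.+1 + n.+1)%N = true) /=; last by lia.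
rewrite !expr0.
by have n0 := ler0n R n; field; posne.
Qed.

(** On the antidiagonal a + b = n + 1, where the two indicators differ, the positive power
    vanishes. *)
Lemma corner_step p n :
  \sum_(1 <= a < n.+1) \sum_(1 <= b < n.+1)
   (n.+1 < a + b)%N%:R * (a%:R + b%:R - n.+1%:R) ^+ p.+1 / (a%:R * b%:R) =
  \sum_(1 <= a < n.+1) \sum_(1 <= b < n.+1)
   (n < a + b)%N%:R * (a%:R + b%:R - n%:R - 1) ^+ p.+1 / (a%:R * b%:R) :> R.
Proof.
apply: eq_big_nat => a _; apply: eq_big_nat => b _; congr (_ / _).
rewrite -(natr1 n) opprD addrA.
have [|ba] := boolP (n.+1 < a + b)%N; first by move=> /ltnW ->.
case: (ltnP n (a + b)) => nab; last by rewrite !mul0r.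
have -> : a%:R + b%:R - n%:R - 1 = 0 :> R.
  by rewrite -natrD (_ : (a + b = n + 1)%N) ?natrD; [ring|lia].
by rewrite expr0n !mulr0.
Qed.

Lemma corner1E n : corner_sum 1 n = 2 * n%:R - n%:R * zetasum 2 n.
Proof.
elim: n => [|n IH]; first by rewrite /corner_sum/zetasum !big_geq// !mul0r mulr0 subr0.
rewrite zetasumS {1}/corner_sum square_recr corner_step.
have -> : \sum_(1 <= a < n.+1) \sum_(1 <= b < n.+1)
   (n < a + b)%N%:R * (a%:R + b%:R - n%:R - 1) ^+ 1 / (a%:R * b%:R) =
   corner_sum 1 n - corner_sum 0 n.
  rewrite /corner_sum -sumrB; apply: eq_big_nat => a _.
  by rewrite -sumrB; apply: eq_big_nat => b _; rewrite -mulrBl !expr1 expr0; ring.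
have -> : \sum_(1 <= a < n.+1)
   ((n.+1 < a + n.+1)%N%:R * (a%:R + n.+1%:R - n.+1%:R) ^+ 1 / (a%:R * n.+1%:R) +
    (n.+1 < n.+1 + a)%N%:R * (n.+1%:R + a%:R - n.+1%:R) ^+ 1 / (n.+1%:R * a%:R))
  = n%:R * (2 / n.+1%:R) :> R.
  rewrite -sum_const1; apply: eq_big_nat => a /andP[a0 an].
  rewrite (_ : (n.+1 < a + n.+1)%N = true); last by lia.
    rewrite (_ : (n.+1 < n.+1 + a)%N = true) /=; last by lia.
  have : 0 < a%:R :> R by rewrite ltr0n.
  by move=> ?; have n0 := ler0n R n; field; posne.
rewrite (_ : (n.+1 < n.+1 + n.+1)%N = true) /=; last by lia.
rewrite !expr1 corner0E IH -(natr1 n).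
have : 0 < n%:R + 1 :> R by rewrite natr1 ltr0n.
by move=> ?; field; posne.
Qed.

Lemma corner2_inner n :
  \sum_(1 <= a < n.+1) \sum_(1 <= b < n.+1)
   (n.+1 < a + b)%N%:R * (a%:R + b%:R - n.+1%:R) ^+ 2 / (a%:R * b%:R) =
   corner_sum 2 n - 2 * corner_sum 1 n + corner_sum 0 n.
Proof.
rewrite corner_step /corner_sum mulr_sumr -sumrB -big_split/=.
apply: eq_big_nat => a _.
rewrite mulr_sumr -sumrB -big_split/=; apply: eq_big_nat => b _.
by rewrite !mulrA -mulrBl -mulrDl !expr1 expr0; congr (_ * _); ring.
Qed.


Lemma corner2E n :
  corner_sum 2 n = n%:R ^+ 2 * zetasum 2 n - 3 / 2 * (n%:R * (n%:R - 1)).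
Proof.
elim: n => [|n IH]; first by rewrite /corner_sum/zetasum !big_geq//; ring.
rewrite zetasumS {1}/corner_sum square_recr corner2_inner.
have -> : \sum_(1 <= a < n.+1)
   ((n.+1 < a + n.+1)%N%:R * (a%:R + n.+1%:R - n.+1%:R) ^+ 2 / (a%:R * n.+1%:R) +
    (n.+1 < n.+1 + a)%N%:R * (n.+1%:R + a%:R - n.+1%:R) ^+ 2 / (n.+1%:R * a%:R))
  = n%:R :> R.
  transitivity (2 / n.+1%:R * \sum_(1 <= a < n.+1) a%:R : R).
    rewrite mulr_sumr; apply: eq_big_nat => a /andP[a0 an].
    rewrite (_ : (n.+1 < a + n.+1)%N = true); last by lia.
    rewrite (_ : (n.+1 < n.+1 + a)%N = true) /=; last by lia.
    have : 0 < a%:R :> R by rewrite ltr0n.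
    by move=> ?; have n0 := ler0n R n; field; posne.
  have -> : \sum_(1 <= a < n.+1) a%:R = n%:R * n.+1%:R / 2 :> R.
    elim: (n) => [|k IHk]; first by rewrite big_geq// !mul0r.
    by rewrite sum_recr1 IHk -!natr1; field.
  by have n0 := ler0n R n; field; posne.
rewrite (_ : (n.+1 < n.+1 + n.+1)%N = true) /=; last by lia.
rewrite corner0E corner1E IH -(natr1 n).
have : 0 < n%:R + 1 :> R by rewrite natr1 ltr0n.
by move=> ?; field; posne.
Qed.

End FiniteSums.

(** * Divisor sums and the series of phi(q)/q^3 *)

Section Divisors.

Lemma sum_dvd_from1 (V : nmodType) q n (F : nat -> V) : (0 < q)%N ->
  \sum_(1 <= x < n.+1 | (q %| x)%N) F x =
  \sum_(1 <= u < (n %/ q).+1) F (q * u)%N.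
Proof.
move=> q0; elim: n => [|n IH]; first by rewrite div0n !big_geq.
rewrite big_mkcond sum_recr1 -big_mkcond IH divnS//.
case: ifPn => [qn|_]; last by rewrite addr0.
rewrite add1n sum_recr1; congr (_ + F _).
by rewrite -[LHS](divnK qn) divnS// qn add1n mulnC.
Qed.

Lemma sum_totient_dvd1 n g : (0 < g)%N -> (g <= n)%N ->
  (\sum_(1 <= q < n.+1 | q %| g) totient q)%N = g.
Proof.
move=> g0 gn; rewrite -[RHS]sum_totient_dvd -(big_mkord (dvdn^~ g) totient).
rewrite [RHS]big_ltn_cond// dvd0n; case: eqVneq => [|_]; first by lia.
rewrite [LHS](big_cat_nat _ (n := g.+1))//= [X in (_ + X)%N]big_nat_cond.
by rewrite [X in (_ + X)%N]big1 ?addn0// => q /andP[/andP[gq _] /dvdn_leq]; lia.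
Qed.

Lemma totient_le n : (totient n <= n)%N.
Proof.
rewrite totient_count_coprime big_mkord (leq_trans (leq_sum _ (fun i _ => leq_b1 _)))//.
by rewrite sum1_card card_ord.
Qed.

Variable R : realFieldType.

Lemma gcdn_sum n g : (0 < g)%N -> (g <= n)%N ->
  g%:R = \sum_(1 <= q < n.+1) (totient q)%:R * (q %| g)%N%:R :> R.
Proof.
move=> g0 gn; rewrite -{1}(sum_totient_dvd1 g0 gn) natr_sum big_mkcond/=.
by apply: eq_bigr => q _; case: ifP; rewrite ?mulr1 ?mulr0.
Qed.

Lemma sum_dvd_indicator q n (F : nat -> R) : (0 < q)%N ->
  \sum_(1 <= x < n.+1) (q %| x)%N%:R * F x =
  \sum_(1 <= u < (n %/ q).+1) F (q * u)%N.
Proof.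
move=> q0; rewrite -sum_dvd_from1// [RHS]big_mkcond/=; apply: eq_bigr => x _.
by case: ifP; rewrite ?mul1r ?mul0r.
Qed.

(** Writing gcd as the sum of the totients of its divisors decouples the variables: for
    each q they range independently over the multiples of q. *)
Lemma sum_gcd2 n (F : nat -> nat -> R) :
  \sum_(1 <= x < n.+1) \sum_(1 <= y < n.+1) (gcdn x y)%:R * F x y =
  \sum_(1 <= q < n.+1) (totient q)%:R *
    \sum_(1 <= u < (n %/ q).+1) \sum_(1 <= v < (n %/ q).+1) F (q * u)%N (q * v)%N.
Proof.
transitivity (\sum_(1 <= q < n.+1) (totient q)%:R *
    \sum_(1 <= x < n.+1) (q %| x)%N%:R *
    \sum_(1 <= y < n.+1) (q %| y)%N%:R * F x y).
  under [RHS]eq_bigr => q _ do rewrite mulr_sumr.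
  rewrite [RHS]exchange_big/=; apply: eq_big_nat => x /andP[x0 xn].
  under [RHS]eq_bigr => q _ do rewrite !mulr_sumr.
  rewrite [RHS]exchange_big/=; apply: eq_big_nat => y /andP[y0 yn].
  rewrite (@gcdn_sum n) ?gcdn_gt0 ?x0//; last first.
    by rewrite (leq_trans (dvdn_leq x0 (dvdn_gcdl _ _))).
  rewrite mulr_suml; apply: eq_bigr => q _.
  by rewrite dvdn_gcd -mulnb natrM !mulrA.
apply: eq_big_nat => q /andP[q0 _]; congr (_ * _).
by rewrite sum_dvd_indicator//; apply: eq_bigr => u _; rewrite sum_dvd_indicator.
Qed.

Lemma sum_gcd3 n (F : nat -> nat -> nat -> R) :
  \sum_(1 <= x < n.+1) \sum_(1 <= y < n.+1) \sum_(1 <= z < n.+1)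
     (gcdn (gcdn x y) z)%:R * F x y z =
  \sum_(1 <= q < n.+1) (totient q)%:R *
    \sum_(1 <= u < (n %/ q).+1) \sum_(1 <= v < (n %/ q).+1)
    \sum_(1 <= w < (n %/ q).+1) F (q * u)%N (q * v)%N (q * w)%N.
Proof.
transitivity (\sum_(1 <= q < n.+1) (totient q)%:R *
    \sum_(1 <= x < n.+1) (q %| x)%N%:R *
    \sum_(1 <= y < n.+1) (q %| y)%N%:R *
    \sum_(1 <= z < n.+1) (q %| z)%N%:R * F x y z).
  under [RHS]eq_bigr => q _ do rewrite mulr_sumr.
  rewrite [RHS]exchange_big/=; apply: eq_big_nat => x /andP[x0 xn].
  under [RHS]eq_bigr => q _ do rewrite !mulr_sumr.
  rewrite [RHS]exchange_big/=; apply: eq_big_nat => y /andP[y0 yn].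
  under [RHS]eq_bigr => q _ do rewrite !mulr_sumr.
  rewrite [RHS]exchange_big/=; apply: eq_big_nat => z /andP[z0 zn].
  rewrite (@gcdn_sum n) ?gcdn_gt0 ?x0//; last first.
    by rewrite (leq_trans (dvdn_leq z0 (dvdn_gcdr _ _))).
  rewrite mulr_suml; apply: eq_bigr => q _.
  by rewrite !dvdn_gcd -!mulnb !natrM !mulrA.
apply: eq_big_nat => q /andP[q0 _]; congr (_ * _).
rewrite sum_dvd_indicator//; apply: eq_bigr => u _; rewrite sum_dvd_indicator//.
by apply: eq_bigr => v _; rewrite sum_dvd_indicator.
Qed.

Lemma sum_inv_max n :
  \sum_(1 <= u < n.+1) \sum_(1 <= v < n.+1) (maxn u v)%:R^-1 <= 2 * n%:R :> R.
Proof.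
elim: n => [|n IH]; first by rewrite big_geq// mulr0.
rewrite square_recr maxnn.
have -> : \sum_(1 <= a < n.+1) ((maxn a n.+1)%:R^-1 + (maxn n.+1 a)%:R^-1) =
   n%:R * (2 / n.+1%:R) :> R.
  rewrite -sum_const1; apply: eq_big_nat => a /andP[_ an].
  by rewrite (maxn_idPr _) ?(maxn_idPl _) ?(ltnW an)//; ring.
rewrite -(natr1 n) mulrDr mulr1 -addrA lerD// -subr_ge0.
have n0 := ler0n R n.
by rewrite (_ : _ - _ = (n%:R + 1)^-1) ?invr_ge0 ?addr_ge0//; field; posne.
Qed.

(** The bound behind both mean-square estimates: only one logarithm is lost. *)
Lemma sum_gcd_div_max n :
  \sum_(1 <= x < n.+1) \sum_(1 <= y < n.+1) (gcdn x y)%:R / (maxn x y)%:R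
    <= 2 * n%:R * harm R n.
Proof.
rewrite sum_gcd2 /harm mulr_sumr; apply: ler_sum1 => q q0 qn.
have q0' : 0 < q%:R :> R by rewrite ltr0n.
apply: (@le_trans _ _ (q%:R * (q%:R^-1 * (2 * (n %/ q)%:R)))).
  apply: ler_pM => //; first by do 2!apply: sumr_ge0 => ? _; rewrite invr_ge0.
    by rewrite ler_nat totient_le.
  rewrite (le_trans _ (ler_wpM2l _ (sum_inv_max _))) ?invr_ge0 ?(ltW q0')//.
  rewrite mulr_sumr; under [leRHS]eq_bigr => u _ do rewrite mulr_sumr.
  do 2!(apply: ler_sum => ? _); rewrite -maxnMr natrM invfM//.
rewrite mulVKf ?gt_eqF// -mulrA ler_pM2l// ler_pdivlMr// -natrM ler_nat.
exact: leq_divM.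
Qed.

(** The identity n = sum of phi(d) over d | n, divided by n^3 and summed over n. *)
Lemma zetasum_totient n :
  zetasum R 2 n = \sum_(1 <= d < n.+1) (totient d)%:R / d%:R ^+ 3 * zetasum R 3 (n %/ d).
Proof.
transitivity (\sum_(1 <= d < n.+1) (totient d)%:R *
  \sum_(1 <= x < n.+1) (d %| x)%N%:R * (x%:R ^+ 3)^-1 : R).
  under [RHS]eq_bigr => d _ do rewrite mulr_sumr.
  rewrite [RHS]exchange_big/=; apply: eq_big_nat => x /andP[x0 xn].
  under eq_bigr do rewrite mulrA.
  rewrite -mulr_suml -gcdn_sum//.
  have : 0 < x%:R :> R by rewrite ltr0n.
  by move=> ?; field; posne.
apply: eq_big_nat => d /andP[d0 _]; rewrite sum_dvd_indicator// -mulrA; congr (_ * _).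
by rewrite mulr_sumr; apply: eq_bigr => u _; rewrite natrM exprMn invfM.
Qed.

(** In the preceding identity each inner partial sum of zeta(3), of length n/d, may be
    completed at a cost O((d/n)^2). *)
Lemma totient_zeta (z2 z3 : R) n :
  (forall k, (0 < k)%N -> `|zetasum R 2 k - z2| <= k%:R^-1) ->
  (forall k, (0 < k)%N -> 0 <= z3 - zetasum R 3 k <= (k%:R ^+ 2)^-1) ->
  (0 < n)%N ->
  `|\sum_(1 <= d < n.+1) (totient d)%:R / d%:R ^+ 3 - z2 / z3| <= 5 / n%:R.
Proof.
move=> h2 h3 n0; set F := \sum_(_ <= _ < _) _.
have z31 : 1 <= z3.
  by have /andP[] := h3 1%N isT; rewrite {1}/zetasum big_nat1 expr1n invr1; lra.
have n0' : 0 < n%:R :> R by rewrite ltr0n.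
have h : `|z3 * F - zetasum R 2 n| <= 4 / n%:R.
  rewrite zetasum_totient mulr_sumr -sumrB (le_trans (ler_norm_sum _ _ _))//.
  rewrite (_ : 4 / n%:R = n%:R * (4 / n%:R ^+ 2)); last by field; posne.
  rewrite -sum_const1; apply: ler_sum1 => d d0 dn.
  have d0' : 0 < d%:R :> R by rewrite ltr0n.
  rewrite mulrC -mulrBr normrM.
  have nd0 : (0 < n %/ d)%N by rewrite divn_gt0.
  have /andP[l u] := h3 _ nd0; rewrite (ger0_norm l).
  have nd : n%:R <= 2 * (n %/ d)%:R * d%:R :> R.
    rewrite -!natrM ler_nat; move: (ltn_ceil n d0) nd0; set v := (n %/ d)%N; nia.
  have nd0' : 0 < (n %/ d)%:R :> R by rewrite ltr0n.
  apply: (@le_trans _ _ (d%:R ^- 2 * (n %/ d)%:R ^- 2)).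
    apply: ler_pM => //; rewrite ger0_norm; last by rewrite divr_ge0// exprn_ge0.
    rewrite exprS invfM mulrA ler_piMl ?invr_ge0 ?exprn_ge0//.
    by rewrite ler_pdivrMr// mul1r ler_nat totient_le.
  rewrite -invfM -[leLHS]div1r ler_pdivlMr ?exprn_gt0//.
  rewrite mulrAC mul1r ler_pdivrMr ?mulr_gt0 ?exprn_gt0//.
  rewrite (_ : 4 * _ = (2 * (n %/ d)%:R * d%:R) ^+ 2); last by ring.
  by rewrite ler_sqr ?nnegrE ?mulr_ge0// ltW.
have h' := h2 _ n0.
have h'' : `|z3 * F - z2| <= 5 / n%:R.
  rewrite (le_trans (ler_distD (zetasum R 2 n) _ _))// (le_trans (lerD h h'))//.
  by rewrite -[X in _ + X]mul1r -mulrDl ler_wpM2r ?invr_ge0//; lra.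
rewrite (_ : F - _ = z3^-1 * (z3 * F - z2)); last by field; posne.
rewrite normrM ger0_norm ?invr_ge0; last by lra.
by rewrite (le_trans _ h'')// ler_piMl// invf_le1//; lra.
Qed.

End Divisors.

(** * Counting i + j + k = 0 in a box *)

Section Hexagon.
Local Open Scope nat_scope.

(** Triples with |i| <= A, |j| <= B, |k| <= C and i + j + k = 0, each coordinate shifted to
    start at 0. *)
Definition hexcount (A B C : nat) : nat :=
  \sum_(i < A.*2.+1) \sum_(j < B.*2.+1) \sum_(k < C.*2.+1)
    (i + j + k == A + B + C).

Lemma hexcountC12 A B C : hexcount A B C = hexcount B A C.
Proof.
rewrite /hexcount exchange_big/=; apply: eq_bigr => j _; apply: eq_bigr => i _.
by apply: eq_bigr => k _; rewrite (addnC i) (addnC A).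
Qed.

Lemma hexcountC23 A B C : hexcount A B C = hexcount A C B.
Proof.
rewrite /hexcount; apply: eq_bigr => j _; rewrite exchange_big/=.
by do 2!apply: eq_bigr => ? _; rewrite addnAC (addnAC A).
Qed.

Lemma sum_pred_eq N a b : \sum_(k < N) (a + k == b) = (a <= b < a + N).
Proof.
elim: N => [|N IH]; first by rewrite big_ord0 addn0; case: leqP => //=; lia.
rewrite big_ord_recr IH/=; lia.
Qed.

Lemma sum_lt N s i : \sum_(j < N) (i + j < s) = minn N (s - i).
Proof.
elim: N => [|N IH]; first by rewrite big_ord0 min0n.
by rewrite big_ord_recr/= IH; lia.
Qed.

Lemma sum_triangle t M N : t <= M -> t <= N ->
  2 * \sum_(i < M) \sum_(j < N) (i + j < t) = t * t.+1.
Proof.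
move=> tM tN; under eq_bigr do rewrite sum_lt.
elim: t M tM tN => [|t IH] M tM tN.
  by rewrite big1 ?muln0// => i _; rewrite minnC.
case: M tM => [//|M] tM; rewrite big_ord_recl mulnDr.
under eq_bigr => i _ do rewrite lift0 subSS.
rewrite IH ?(ltnW tN)//= subn0 (minn_idPr tN); lia.
Qed.

(** When C is the largest bound, k is determined by i and j, and the pairs (i, j) with
    |i + j| > C form two opposite triangles in the rectangle. *)
Lemma hexcountE A B C : A <= C -> B <= C ->
  hexcount A B C + (A + B - C) * (A + B - C).+1 = A.*2.+1 * B.*2.+1.
Proof.
move=> AC BC; set t := A + B - C.
have tA : t <= A.*2.+1 by lia.
have tB : t <= B.*2.+1 by lia.
rewrite -(sum_triangle tA tB) mul2n -addnn.
rewrite {2}(reindex_inj rev_ord_inj)/=.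
under [X in _ + (_ + X)]eq_bigr do rewrite (reindex_inj rev_ord_inj)/=.
rewrite addnA -!big_split/=.
transitivity (\sum_(i < A.*2.+1) \sum_(j < B.*2.+1) 1); last first.
  by under eq_bigr do rewrite sum1_card card_ord; rewrite sum_nat_const card_ord.
apply: eq_bigr => -[i iA] _ /=; rewrite -!big_split/=.
apply: eq_bigr => -[j jB] _ /=; rewrite sum_pred_eq /t; lia.
Qed.

End Hexagon.

Section Cube.
Variable V : comPzRingType.

(** Sorts the points of the cube by their largest coordinate; symmetry lets that coordinate
    be the last one. *)
Lemma cube_sym n (F : nat -> nat -> nat -> V) :
  (forall a b c, F a b c = F b a c) -> (forall a b c, F a b c = F a c b) ->
  \sum_(1 <= a < n.+1) \sum_(1 <= b < n.+1) \sum_(1 <= c < n.+1) F a b c =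
  \sum_(1 <= k < n.+1) (3 * \sum_(1 <= a < k) \sum_(1 <= b < k) F a b k +
     3 * \sum_(1 <= a < k) F a k k + F k k k).
Proof.
move=> F12 F23; elim: n => [|n IH]; first by rewrite !big_geq.
rewrite [RHS]sum_recr1 -IH sum_recr1 square_recr.
under eq_bigr => a _ do rewrite square_recr.
rewrite !big_split/=; under [X in _ + X + _ + _]eq_bigr do rewrite big_split/=.
rewrite big_split/=.
have -> : \sum_(1 <= i < n.+1) \sum_(1 <= j < n.+1) F i n.+1 j =
          \sum_(1 <= i < n.+1) \sum_(1 <= j < n.+1) F i j n.+1.
  by do 2!apply: eq_bigr => ? _; rewrite F23.
have -> : \sum_(1 <= i < n.+1) \sum_(1 <= j < n.+1) F n.+1 i j =
          \sum_(1 <= i < n.+1) \sum_(1 <= j < n.+1) F i j n.+1.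
  by do 2!apply: eq_bigr => ? _; rewrite F12 F23.
have -> : \sum_(1 <= i < n.+1) F n.+1 i n.+1 = \sum_(1 <= i < n.+1) F i n.+1 n.+1.
  by apply: eq_bigr => ? _; rewrite F12.
have -> : \sum_(1 <= i < n.+1) F n.+1 n.+1 i = \sum_(1 <= i < n.+1) F i n.+1 n.+1.
  by apply: eq_bigr => ? _; rewrite F23 F12.
ring.
Qed.
End Cube.

(** * The main term *)

Section MainTerm.
Variable R : realFieldType.

Definition hexsum (m T : nat) : R :=
  \sum_(1 <= a < T.+1) \sum_(1 <= b < T.+1) \sum_(1 <= c < T.+1)
    (hexcount (a * m) (b * m) (c * m))%:R / (a%:R * b%:R * c%:R).

(** The error is linear in the sides of the hexagon; divided by the product of the three
    coordinates it leaves m/(k a) and m/(k b). *)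
Lemma hex_approx m a b k : (0 < m)%N -> (0 < a)%N -> (0 < b)%N ->
  (a <= k)%N -> (b <= k)%N ->
  `|(hexcount (a * m) (b * m) (k * m))%:R / (a%:R * b%:R * k%:R)
    - m%:R ^+ 2 * (4 / k%:R -
       (k < a + b)%N%:R * (a%:R + b%:R - k%:R) ^+ 2 / (a%:R * b%:R) / k%:R)|
  <= 3 * m%:R / k%:R * (a%:R^-1 + b%:R^-1) :> R.
Proof.
move=> m0 a0 b0 ak bk.
have := @hexcountE (a * m) (b * m) (k * m); rewrite !leq_mul2r ak bk !orbT => /(_ isT isT).
rewrite -mulnDl -mulnBl; set t := (a + b - k)%N => /(congr1 (fun x => x%:R : R)).
have -> : (k < a + b)%N%:R * (a%:R + b%:R - k%:R) ^+ 2 = t%:R ^+ 2 :> R.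
  case: ltnP => kab; first by rewrite mul1r /t natrB ?natrD// ltnW.
  by rewrite mul0r (_ : t = 0%N) ?expr0n//; apply/eqP; rewrite subn_eq0.
have tab : t%:R <= a%:R + b%:R :> R by rewrite -natrD ler_nat leq_subr.
rewrite natrD !natrM -!natr1 -!muln2 !natrM => /(canRL (addrK _)) ->.
have [a1 b1] : 1 <= a%:R :> R /\ 1 <= b%:R :> R by rewrite !ler1n.
have m1 : 1 <= m%:R :> R by rewrite ler1n.
have k1 : 1 <= k%:R :> R by rewrite ler1n (leq_trans a0).
have t0 := ler0n R t.
move: (a%:R) (b%:R) (m%:R) (k%:R) (t%:R) a1 b1 m1 k1 t0 tab => {a0 b0 ak bk m0}.
move=> {}a {}b {}m {}k {}t a1 b1 m1 k1 t0 tab.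
rewrite (_ : _ - _ = (2 * (a + b) * m + 1 - t * m) / (a * b * k)); last first.
  by field; posne.
rewrite [leRHS](_ : _ = (3 * m * (a + b)) / (a * b * k)); last by field; posne.
have abk : 0 < a * b * k by rewrite !mulr_gt0//; lra.
rewrite ger0_norm; first by rewrite ler_wpM2r ?invr_ge0 ?(ltW abk)//; nra.
by rewrite divr_ge0 ?(ltW abk)//; nra.
Qed.

Lemma corner2_innerE n :
  \sum_(1 <= a < n.+1) \sum_(1 <= b < n.+1)
   (n.+1 < a + b)%N%:R * (a%:R + b%:R - n.+1%:R) ^+ 2 / (a%:R * b%:R) =
   n.+1%:R ^+ 2 * zetasum R 2 n - (3 * n%:R ^+ 2 + 5 * n%:R) / 2 :> R.
Proof.
by rewrite corner2_inner corner2E corner1E corner0E -(natr1 n); field.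
Qed.

Lemma hex_layer m n z : (0 < m)%N ->
  `|zetasum R 2 n.+1 - z| <= n.+1%:R^-1 ->
  `|\sum_(1 <= a < n.+1) \sum_(1 <= b < n.+1)
      (hexcount (a * m) (b * m) (n.+1 * m))%:R / (a%:R * b%:R * n.+1%:R)
    - m%:R ^+ 2 * (11 / 2 - z) * n.+1%:R| <= 16 * m%:R ^+ 2 * harm R n.+1.
Proof.
move=> m0 hz; set k := n.+1; set S := \sum_(_ <= _ < _) _.
have k1 : 1 <= k%:R :> R by rewrite ler1n.
have kn : k%:R = n%:R + 1 :> R by rewrite natr1.
have m1 : 1 <= m%:R :> R by rewrite ler1n.
have H1 : 1 <= harm R k by apply: harm_ge1.
(* The sum over a, b of the main part in [hex_approx]. *)
pose A : R := m%:R ^+ 2 * (4 * n%:R ^+ 2 / k%:R - k%:R * zetasum R 2 n +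
  (3 * n%:R ^+ 2 + 5 * n%:R) / 2 / k%:R).
have SA : `|S - A| <= 6 * m%:R * harm R k.
  have AE : A = \sum_(1 <= a < n.+1) \sum_(1 <= b < n.+1)
    m%:R ^+ 2 * (4 / k%:R -
       (k < a + b)%N%:R * (a%:R + b%:R - k%:R) ^+ 2 / (a%:R * b%:R) / k%:R).
    under eq_bigr do rewrite -mulr_sumr.
    rewrite -mulr_sumr; congr (_ * _).
    under eq_bigr do rewrite sumrB sum_const1 -[X in _ - X]mulr_suml.
    rewrite sumrB sum_const1 -[X in _ = _ - X]mulr_suml /k corner2_innerE -/k.
    by field; posne.
  rewrite AE -sumrB (le_trans (ler_norm_sum _ _ _))//.
  apply: (@le_trans _ _ (\sum_(1 <= a < n.+1) \sum_(1 <= b < n.+1)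
     (3 * m%:R / k%:R * (a%:R^-1 + b%:R^-1)))).
    apply: ler_sum1 => a a0 an; rewrite -sumrB (le_trans (ler_norm_sum _ _ _))//.
    by apply: ler_sum1 => b b0 bn; apply: hex_approx => //; apply: leqW.
  under eq_bigr do rewrite -mulr_sumr big_split/= sum_const1 -/(harm R n).
  rewrite -mulr_sumr big_split/= sum_const1 -mulr_sumr -/(harm R n).
  rewrite [leLHS](_ : _ = 6 * m%:R * harm R n * (n%:R / k%:R)); last by field; posne.
  have nk : n%:R / k%:R <= 1 :> R by rewrite ler_pdivrMr ?mul1r ?kn; lra.
  rewrite (le_trans (ler_piMr _ nk))//; last first.
    by rewrite ler_wpM2l ?harm_homo// mulr_ge0//; lra.
  by rewrite mulr_ge0 ?harm_ge0// mulr_ge0//; lra.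
have AM : `|A - m%:R ^+ 2 * (11 / 2 - z) * k%:R| <= 10 * m%:R ^+ 2.
  have -> : A - m%:R ^+ 2 * (11 / 2 - z) * k%:R = m%:R ^+ 2 *
    (- (17 / 2) + 4 / k%:R - k%:R * (zetasum R 2 k - z)).
    by rewrite /A zetasumS -/k; rewrite (_ : n%:R = k%:R - 1 :> R); [field; posne|lra].
  rewrite normrM ger0_norm ?exprn_ge0// mulrC ler_wpM2r ?exprn_ge0//.
  have k2 : 0 <= (k%:R : R)^-1 <= 1 by rewrite invr_ge0 invf_le1//; lra.
  have : `|k%:R * (zetasum R 2 k - z)| <= 1.
    rewrite normrM ger0_norm; last by lra.
    have kn0 : k%:R != 0 :> R by posne.
    by rewrite (le_trans (ler_wpM2l _ hz)) ?divff//; lra.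
  by rewrite !ler_norml; lra.
rewrite (le_trans (ler_distD A _ _))// (le_trans (lerD SA AM))//.
have : m%:R <= m%:R ^+ 2 :> R by rewrite expr2 ler_peMr//; lra.
move: (m%:R ^+ 2) => M; nra.
Qed.

(** The layer with largest coordinate k contributes 3 (11/2 - z) k m^2 up to O(m^2 H_T), and
    the sum of k over k <= T is T^2/2 + O(T). *)
Lemma hexsum_asymp m T z : (0 < m)%N ->
  (forall k, (0 < k)%N -> `|zetasum R 2 k - z| <= k%:R^-1) ->
  `|hexsum m T - (33 / 4 - 3 / 2 * z) * (m%:R * T%:R) ^+ 2|
    <= 93 * m%:R ^+ 2 * (T%:R * harm R T).
Proof.
move=> m0 hz; rewrite /hexsum cube_sym; last 2 first.
- by move=> a b c; rewrite hexcountC12 (mulrC a%:R).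
- by move=> a b c; rewrite hexcountC23 mulrAC.
have m1 : 1 <= m%:R :> R by rewrite ler1n.
pose L k : R := 3 * (m%:R ^+ 2 * (11 / 2 - z) * k%:R).
set F := BIG_F.
have FL k : (0 < k)%N -> (k <= T)%N -> `|F k - L k| <= 84 * m%:R ^+ 2 * harm R T.
  case: k => [//|k] _ kT; rewrite {}/F /L.
  have := hex_layer m0 (hz k.+1 isT).
  set S := \sum_(_ <= _ < _) _ => h1.
  have f0 a : (0 < a)%N -> (a <= k.+1)%N -> 0 <= (hexcount (a * m) (k.+1 * m) (k.+1 * m))%:R /
         ((a%:R : R) * k.+1%:R * k.+1%:R) <= 9 * m%:R ^+ 2 / k.+1%:R.
    move=> a0 ak; apply/andP; split; first by rewrite divr_ge0// !mulr_ge0.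
    have h := @hexcountE (a * m) (k.+1 * m) (k.+1 * m).
    have {h} : (hexcount (a * m) (k.+1 * m) (k.+1 * m) <= (a * m).*2.+1 * (k.+1 * m).*2.+1)%N.
      by rewrite -h ?leq_addr// leq_mul2r ak orbT.
    rewrite -(ler_nat R) natrM -!natr1 -!muln2 !natrM => h.
    have a1 : 1 <= a%:R :> R by rewrite ler1n.
    have k1 : 1 <= k.+1%:R :> R by rewrite ler1n.
    rewrite ler_pdivrMr; last by rewrite !mulr_gt0//; lra.
    rewrite (_ : _ / _ * _ = 9 * m%:R ^+ 2 * a%:R * k.+1%:R); last first.
      by have k0 := ler0n R k; field; posne.
    apply: le_trans h _; move: (k.+1%:R) k1 => K k1.
    rewrite (_ : 9 * _ * _ * _ = (3 * (a%:R * m%:R)) * (3 * (K * m%:R))); last by ring.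
    have am : 1 <= a%:R * m%:R :> R by apply: mulr_ege1.
    have km : 1 <= K * m%:R :> R by apply: mulr_ege1.
    by apply: ler_pM; lra.
  have /andP[g0 g9] := f0 k.+1 isT (leqnn _).
  set G := \sum_(1 <= a < k.+1) (_ / (_ * k.+1%:R * k.+1%:R)).
  have G0 : 0 <= G.
    rewrite /G big_nat_cond; apply: sumr_ge0 => a /andP[/andP[a0 ak] _].
    by have /andP[] := f0 a a0 (ltnW ak).
  have GM : G <= 9 * m%:R ^+ 2.
    apply: (@le_trans _ _ (k%:R * (9 * m%:R ^+ 2 / k.+1%:R))).
      rewrite -sum_const1; apply: ler_sum1 => a a0 ak.
      by have /andP[] := f0 a a0 (leqW ak).
    rewrite mulrCA ler_piMr ?mulr_ge0 ?exprn_ge0//.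
    by rewrite ler_pdivrMr// mul1r ler_nat.
  have g9' : (hexcount (k.+1 * m) (k.+1 * m) (k.+1 * m))%:R /
         (k.+1%:R * k.+1%:R * k.+1%:R) <= 9 * m%:R ^+ 2 :> R.
    apply: le_trans g9 _; rewrite ler_piMr ?mulr_ge0 ?exprn_ge0//.
    by rewrite invf_le1// ler1n.
  have HT := harm_homo R kT.
  have H1 : 1 <= harm R k.+1 by apply: harm_ge1.
  have M0 : 0 <= m%:R ^+ 2 :> R by rewrite exprn_ge0.
  have MH := ler_wpM2l M0 HT; have MH1 := ler_wpM2l M0 H1; rewrite mulr1 in MH1.
  move: h1 g0 g9' G0 GM MH MH1; rewrite !ler_norml.
  move: (_ / (_ * _ * _)) => g; lra.
have H0 := harm_ge0 R T.
have h : `|\sum_(1 <= k < T.+1) F k - \sum_(1 <= k < T.+1) L k| <=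
   T%:R * (84 * m%:R ^+ 2 * harm R T).
  rewrite -sumrB (le_trans (ler_norm_sum _ _ _))// -sum_const1.
  exact: ler_sum1.
have LE : \sum_(1 <= k < T.+1) L k =
   (33 / 4 - 3 / 2 * z) * m%:R ^+ 2 * (T%:R ^+ 2 + T%:R).
  rewrite /L; elim: (T) => [|t IH]; first by rewrite big_geq//; ring.
  by rewrite sum_recr1 IH -natr1; field.
case: (posnP T) => [->|T0].
  by rewrite big_geq// !mul0r !mulr0 expr0n/= mulr0 subr0 normr0.
have H1 : 1 <= harm R T by apply: harm_ge1.
have z02 : 0 <= z <= 2.
  by have := hz 1%N isT; rewrite /zetasum big_nat1 expr1n invr1 ler_norml; lra.
rewrite (le_trans (ler_distD (\sum_(1 <= k < T.+1) L k) _ _))//.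
rewrite (le_trans (lerD h (lexx _)))// LE.
rewrite (_ : _ * _ * _ - _ = (33 / 4 - 3 / 2 * z) * (m%:R ^+ 2 * T%:R)); last by ring.
have M0 : 0 <= m%:R ^+ 2 * T%:R :> R by rewrite mulr_ge0 ?exprn_ge0.
rewrite normrM (ger0_norm M0) (_ : 93 * _ * _ = m%:R ^+ 2 * T%:R * (93 * harm R T)); last by ring.
rewrite (_ : T%:R * _ = m%:R ^+ 2 * T%:R * (84 * harm R T)); last by ring.
rewrite [X in _ + X]mulrC -mulrDr ler_wpM2l// ger0_norm; lra.
Qed.

(** The diagonal contribution to the count; the weight gcd is the number of fractions whose
    denominator divides all three coordinates. *)
Definition mainsum (n m : nat) : R :=
  \sum_(1 <= a < n.+1) \sum_(1 <= b < n.+1) \sum_(1 <= c < n.+1)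
    (gcdn (gcdn a b) c)%:R *
    ((hexcount (a * m) (b * m) (c * m))%:R / (a%:R * b%:R * c%:R)).

Lemma mainsumE n m : mainsum n m =
  \sum_(1 <= q < n.+1) (totient q)%:R / q%:R ^+ 3 * hexsum (q * m) (n %/ q).
Proof.
rewrite /mainsum sum_gcd3; apply: eq_big_nat => q /andP[q0 _].
rewrite -mulrA; congr (_ * _); rewrite mulr_sumr; apply: eq_bigr => a _.
rewrite mulr_sumr; apply: eq_bigr => b _.
rewrite mulr_sumr; apply: eq_bigr => c _.
have E x : (q * x * m = x * (q * m))%N by rewrite mulnA (mulnC q).
by rewrite !E [RHS]mulrCA -invfM !natrM; congr (_ * _^-1); ring.
Qed.

(** Three successive replacements, with intermediate values A and B: the hexagon sums by
    their asymptotic values, the integer part of n/q by n/q, and the truncated series of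
    phi(q)/q^3 by w.  Each costs O(n m^2) up to logarithms. *)
Lemma mainsum_asymp n m z w D : (0 < n)%N -> (0 < m)%N -> 
  (forall k, (0 < k)%N -> `|zetasum R 2 k - z| <= k%:R^-1) ->
  `|\sum_(1 <= d < n.+1) (totient d)%:R / d%:R ^+ 3 - w| <= D / n%:R ->
  `|mainsum n m - (33 / 4 - 3 / 2 * z) * w * (n%:R * m%:R) ^+ 2|
    <= (111 + 9 * D) * (n%:R * m%:R ^+ 2 * harm R n ^+ 2).
Proof.
move=> n0 m0 hz hw; rewrite mainsumE.
set c := 33 / 4 - _.
have z02 : 0 <= z <= 2.
  by have := hz 1%N isT; rewrite /zetasum big_nat1 expr1n invr1 ler_norml; lra.
have n1 : 1 <= n%:R :> R by rewrite ler1n.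
have m1 : 1 <= m%:R :> R by rewrite ler1n.
have H1 : 1 <= harm R n by apply: harm_ge1.
have tq q : (0 < q)%N -> 0 <= ((totient q)%:R : R) / q%:R <= 1.
  by move=> q0; rewrite divr_ge0// ler_pdivrMr ?ltr0n// mul1r ler_nat totient_le.
pose A : R := \sum_(1 <= q < n.+1) (totient q)%:R / q%:R *
  (c * m%:R ^+ 2 * (n %/ q)%:R ^+ 2).
pose B : R := \sum_(1 <= q < n.+1) (totient q)%:R / q%:R *
  (c * m%:R ^+ 2 * (n%:R / q%:R) ^+ 2).
have dq q : (0 < q)%N -> (n %/ q)%:R <= n%:R / q%:R :> R.
  by move=> q0; rewrite ler_pdivlMr ?ltr0n// -natrM ler_nat leq_divM.
have dq1 q : (0 < q)%N -> n%:R / q%:R <= (n %/ q)%:R + 1 :> R.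
  move=> q0; rewrite ler_pdivrMr ?ltr0n// natr1 -natrM ler_nat ltnW//.
  exact: ltn_ceil.
have hA : `|\sum_(1 <= q < n.+1) (totient q)%:R / q%:R ^+ 3 * hexsum (q * m) (n %/ q) - A|
   <= 93 * (n%:R * m%:R ^+ 2 * harm R n ^+ 2).
  rewrite -sumrB (le_trans (ler_norm_sum _ _ _))//.
  rewrite (_ : 93 * _ = 93 * n%:R * m%:R ^+ 2 * harm R n * harm R n); last by ring.
  rewrite {2}/harm mulr_sumr; apply: ler_sum1 => q q0 qn.
  have q1 : 1 <= q%:R :> R by rewrite ler1n.
  have qm0 : (0 < q * m)%N by rewrite muln_gt0 q0.
  have := hexsum_asymp (n %/ q) qm0 hz; rewrite -/c => h.
  rewrite (_ : _ - _ = (totient q)%:R / q%:R * q%:R ^- 2 *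
     (hexsum (q * m) (n %/ q) - c * ((q * m)%:R * (n %/ q)%:R) ^+ 2)); last first.
    by rewrite natrM; field; posne.
  have /andP[t0 t1] := tq q q0.
  rewrite normrM ger0_norm; last by rewrite mulr_ge0 ?invr_ge0 ?exprn_ge0.
  rewrite -[leLHS]mulrA (le_trans (ler_piMl _ t1))//.
  rewrite mulrC ler_pdivrMr ?exprn_gt0 ?ltr0n// (le_trans h)//.
  rewrite natrM exprMn (_ : _ / _ * _ =
    93 * (q%:R ^+ 2 * m%:R ^+ 2) * (n%:R / q%:R * harm R n)); last by field; posne.
  apply: ler_wpM2l; first by rewrite !mulr_ge0// exprn_ge0.
  by apply: ler_pM => //; rewrite ?harm_ge0 ?dq// harm_homo// leq_div.
have c9 : 0 <= c <= 9 by rewrite /c; lra.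
have hB : `|A - B| <= 18 * (n%:R * m%:R ^+ 2 * harm R n ^+ 2).
  rewrite -sumrB (le_trans (ler_norm_sum _ _ _))//.
  apply: (@le_trans _ _ (18 * (n%:R * m%:R ^+ 2 * harm R n))); last first.
    rewrite ler_wpM2l// ler_wpM2l ?mulr_ge0 ?exprn_ge0//.
    by rewrite expr2 ler_peMr// harm_ge0.
  rewrite mulrA /harm mulr_sumr; apply: ler_sum1 => q q0 qn.
  have /andP[t0 t1] := tq q q0.
  rewrite -mulrBr -mulrBr normrM (ger0_norm t0)// (le_trans (ler_piMl _ t1))//.
  have c0 : 0 <= c by case/andP: c9.
  rewrite normrM (ger0_norm (mulr_ge0 c0 (exprn_ge0 2 (ler0n R m)))) distrC.
  have l := dq q q0; have u := dq1 q q0; have f0 := ler0n R (n %/ q).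
  have M0 : 0 <= m%:R ^+ 2 :> R by rewrite exprn_ge0.
  have h : `|(n%:R / q%:R) ^+ 2 - (n %/ q)%:R ^+ 2| <= 2 * (n%:R / q%:R) :> R.
    rewrite ger0_norm; last by rewrite subr_ge0 ler_sqr ?nnegrE// (le_trans f0).
    by move: (n%:R / q%:R) ((n %/ q)%:R) l u f0 => x y l u f0; nra.
  rewrite (_ : 18 * _ / _ = 9 * m%:R ^+ 2 * (2 * (n%:R / q%:R))); last by ring.
  case/andP: c9 => _ c9.
  by apply: ler_pM => //; [rewrite mulr_ge0|rewrite ler_wpM2r].
have hC : `|B - c * w * (n%:R * m%:R) ^+ 2| <= 9 * D * (n%:R * m%:R ^+ 2 * harm R n ^+ 2).
  have -> : B = c * (m%:R * n%:R) ^+ 2 *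
      \sum_(1 <= d < n.+1) (totient d)%:R / d%:R ^+ 3.
    rewrite mulr_sumr; apply: eq_big_nat => q /andP[q0 _].
    have q1 : 1 <= q%:R :> R by rewrite ler1n.
    by field; posne.
  rewrite (_ : _ * _ - _ = c * (m%:R * n%:R) ^+ 2 *
      (\sum_(1 <= d < n.+1) (totient d)%:R / d%:R ^+ 3 - w)); last by ring.
  have D0 : 0 <= D.
    by move: (le_trans (normr_ge0 _) hw); rewrite pmulr_lge0// invr_gt0; lra.
  case/andP: c9 => c0 c9.
  rewrite normrM normrM (ger0_norm c0) (ger0_norm (exprn_ge0 _ _)) ?mulr_ge0//.
  apply: (@le_trans _ _ (9 * (m%:R * n%:R) ^+ 2 * (D / n%:R))).
    apply: ler_pM => //; first by rewrite mulr_ge0// exprn_ge0// mulr_ge0.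
    by rewrite ler_wpM2r// exprn_ge0// mulr_ge0.
  rewrite (_ : _ * (D / _) = 9 * D * (n%:R * m%:R ^+ 2)); last by field; posne.
  rewrite [leRHS]mulrA ler_peMr// ?exprn_ege1//.
  by rewrite !mulr_ge0// exprn_ge0.
rewrite (le_trans (ler_distD A _ _))//.
rewrite (_ : (111 + _) * _ = 93 * (n%:R * m%:R ^+ 2 * harm R n ^+ 2) +
   (18 * (n%:R * m%:R ^+ 2 * harm R n ^+ 2) + 9 * D * (n%:R * m%:R ^+ 2 * harm R n ^+ 2)));
  last by ring.
rewrite lerD// (le_trans (ler_distD B _ _))// lerD//.
Qed.

End MainTerm.

(** * Dirichlet kernels and frequencies a/P *)

Section Trig.
Variable R : realType.
Implicit Types (t x y z : R) (n N : nat).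

Lemma ge_from0_derive (f df : R -> R) (b : R) : 0 <= b ->
  (forall x, is_derive x 1 f (df x)) ->
  (forall x, 0 <= x <= b -> 0 <= df x) -> f 0 <= f b.
Proof.
move=> b0 fdf df0.
have cf : {within `[0, b], continuous f}.
  apply: derivable_within_continuous => x _.
  by have [] := fdf x.
have [c cb fE] := MVT_segment b0 (fun x _ => fdf x) cf.
rewrite -subr_ge0 fE subr0 mulr_ge0// df0//.
Qed.

Lemma sin_le t : 0 <= t -> sin t <= t.
Proof.
move=> t0; rewrite -subr_ge0.
have d x : is_derive x 1 (fun y : R => y - sin y) (1 - cos x).
  by apply: is_deriveB.
have := ge_from0_derive t0 d; rewrite sin0 subr0; apply=> x _.
by rewrite subr_ge0 cos_le1.
Qed.

Lemma cos_le_sin t : 0 <= t <= pi -> t * cos t <= sin t.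
Proof.
move=> /andP[t0 tpi]; rewrite -subr_ge0.
have d x : is_derive x 1 (fun y : R => sin y - y * cos y) (x * sin x).
  have := is_deriveB (is_derive_sin x) (is_deriveM (is_derive_id x (1 : R)) (is_derive_cos x)).
  by move/is_derive_eq; apply; rewrite /GRing.scale/=; ring.
have := ge_from0_derive t0 d; rewrite sin0 mul0r subr0; apply=> x /andP[x0 xt].
by rewrite mulr_ge0// sin_ge0_pi// x0/= (le_trans xt).
Qed.

(** From t cos t <= sin t at t/2: sin t = 2 sin(t/2) cos(t/2) >= t cos(t/2)^2, and
    cos(t/2)^2 >= 1/2. *)
Lemma sin_ge_half t : 0 <= t <= pi / 2 -> t / 2 <= sin t.
Proof.
move=> /andP[t0 tpi].
have p0 := pi_gt0 R.
have := cos_le_sin (t := t / 2).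
have -> : 0 <= t / 2 <= pi by apply/andP; split; lra.
move=> /(_ isT) h.
have -> : sin t = 2 * (cos (t / 2) * sin (t / 2)).
  by rewrite mulr_natl -sin_mulr2n; congr sin; rewrite mulr2n; lra.
have c0 : 0 <= cos (t / 2) by apply: cos_ge0_pihalf; apply/andP; split; lra.
have : 0 <= cos t by apply: cos_ge0_pihalf; apply/andP; split; lra.
have -> : cos t = 2 * cos (t / 2) ^+ 2 - 1.
  rewrite mulr_natl -cos_mulr2n; congr cos; rewrite mulr2n; lra.
set c := cos _ in h c0 * => hc.
have := ler_wpM2l c0 h.
have : t / 2 * (1 / 2) <= t / 2 * c ^+ 2 by rewrite ler_wpM2l//; lra.
lra.
Qed.

Lemma sin_pi_ge z : 0 <= z <= 1 -> Num.min z (1 - z) <= sin (pi * z).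
Proof.
have p2 := pi_ge2 R.
have E y : 0 <= y <= 1 / 2 -> y <= sin (pi * y).
  move=> /andP[y0 y2].
  have := @sin_ge_half (pi * y).
  have -> : 0 <= pi * y <= pi / 2.
    apply/andP; split; first by rewrite mulr_ge0//; lra.
    by rewrite ler_wpM2l//; lra.
  by move=> /(_ isT); apply: le_trans; nra.
move=> /andP[z0 z1]; case: (lerP z (1 - z)) => h.
  by apply: E; lra.
have -> : sin (pi * z) = sin (pi * (1 - z)).
  by rewrite mulrBr mulr1 addrC sinDpi sinN opprK.
by apply: E; lra.
Qed.

Lemma sin_add_pi_int x (k : int) : `|sin (x + k%:~R * pi)| = `|sin x|.
Proof.
have E y n : `|sin (y + n%:R * pi)| = `|sin y|.
  by rewrite mulr_natl (alternatingn (@sinDpi R)) normrM normrX normrN1 expr1n mul1r.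
case: k => n; first exact: E.
rewrite -[in RHS](addrNK ((n.+1)%:R * pi) x) E NegzE; congr (`|sin _|).
by rewrite mulrNz mulNr.
Qed.

Lemma cos_add_2pi_int x (k : int) : cos (x + k%:~R * (pi *+ 2)) = cos x.
Proof.
have E y n : cos (y + n%:R * (pi *+ 2)) = cos y.
  by rewrite mulr_natl (periodicn (@cosD2pi R)).
case: k => n; first exact: E.
rewrite -[in RHS](addrNK ((n.+1)%:R * (pi *+ 2)) x) E NegzE; congr (cos _).
by rewrite mulrNz mulNr.
Qed.

Lemma sin_add_2pi_int x (k : int) : sin (x + k%:~R * (pi *+ 2)) = sin x.
Proof.
by rewrite -!cosBpihalf addrAC cos_add_2pi_int.
Qed.

Lemma sum_cos_telescope n (s t : R) :
  \sum_(i < n) cos ((i%:R - s) * t) * (2 * sin (t / 2)) =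
  sin ((n%:R - s - 1 / 2) * t) + sin ((s + 1 / 2) * t).
Proof.
elim: n => [|n IH].
  rewrite big_ord0 -[X in _ = X + _]opprK -sinN.
  rewrite (_ : - _ = (s + 1 / 2) * t) ?addNr//; lra.
rewrite big_ord_recr/= IH.
rewrite (_ : (n.+1%:R - s - 1 / 2) * t = (n%:R - s) * t + t / 2); last by rewrite -natr1; lra.
rewrite (_ : (n%:R - s - 1 / 2) * t = (n%:R - s) * t - t / 2); last by lra.
by rewrite sinB sinD; ring.
Qed.

Lemma sum_sin_telescope n t :
  \sum_(i < n) sin (i%:R * t) * (2 * sin (t / 2)) =
  cos (t / 2) - cos ((n%:R - 1 / 2) * t).
Proof.
elim: n => [|n IH].
  by rewrite big_ord0 -(cosN (t / 2)) (_ : - (t / 2) = (0%:R - 1 / 2) * t) ?subrr//; lra.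
rewrite big_ord_recr/= IH.
rewrite (_ : (n.+1%:R - 1 / 2) * t = n%:R * t + t / 2); last by rewrite -natr1; lra.
rewrite (_ : (n%:R - 1 / 2) * t = n%:R * t - t / 2); last by lra.
by rewrite cosB cosD; ring.
Qed.

(** The index is shifted, so that i - N runs over the integers of absolute value at most N. *)
Definition dirichlet (N : nat) (t : R) : R :=
  \sum_(i < N.*2.+1) cos ((i%:R - N%:R) * t).

Lemma dirichlet_bound N t : `|dirichlet N t| * `|sin (t / 2)| <= 1.
Proof.
have := sum_cos_telescope N.*2.+1 N%:R t.
rewrite -mulr_suml -/(dirichlet N t) => h.
rewrite -normrM.
have -> : dirichlet N t * sin (t / 2) = sin ((N%:R + 1 / 2) * t).
  move: h; rewrite (_ : _ - _ - _ = N%:R + 1 / 2); first by lra.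
  by rewrite -natr1 -muln2 natrM; lra.
exact: sin_max.
Qed.

(** The angle of the frequency k/P, that is 2 pi k/P. *)
Definition angle (P : nat) (k : int) : R := k%:~R * (pi *+ 2) / P%:R.

Lemma angleD P k l : angle P (k + l) = angle P k + angle P l.
Proof. by rewrite /angle intrD !mulrDl. Qed.
Lemma angleN P k : angle P (- k) = - angle P k.
Proof. by rewrite /angle mulrNz !mulNr. Qed.
Lemma angleM P k l : k%:~R * angle P l = angle P (k * l).
Proof. by rewrite /angle intrM !mulrA. Qed.

Lemma angle_period P k : (0 < P)%N -> angle P (P%:Z * k) = k%:~R * (pi *+ 2).
Proof.
move=> P0; have P0' : 0 < P%:R :> R by rewrite ltr0n.
by rewrite /angle intrM -[P%:~R]/(P%:R) mulr2n; field; posne.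
Qed.

Lemma cos_angle_period P k l : (0 < P)%N -> cos (angle P (k + P%:Z * l)) = cos (angle P k).
Proof. by move=> P0; rewrite angleD angle_period// cos_add_2pi_int. Qed.

Lemma sin_half_angle_neq0 P k : (0 < P)%N -> ~~ (P%:Z %| k)%Z -> sin (angle P k / 2) != 0.
Proof.
move=> P0 Pk; have P0' : 0 < P%:R :> R by rewrite ltr0n.
pose r := (k %% P%:Z)%Z; pose q := (k %/ P%:Z)%Z.
have kE : k = q * P%:Z + r := divz_eq k P%:Z.
have r0 : 0 <= r by rewrite modz_ge0//; lia.
have rP : r < P%:Z by rewrite ltz_pmod.
have rn0 : r != 0 by apply: contra Pk => /eqP h; apply/dvdz_mod0P.
rewrite -normr_eq0 (_ : _ / 2 = pi * (r%:~R / P%:R) + q%:~R * pi); last first.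
  by rewrite /angle kE intrD intrM mulr2n; field; posne.
rewrite sin_add_pi_int normr_eq0 gt_eqF//.
have r1 : 0 < r%:~R / P%:R :> R by rewrite divr_gt0// ltr0z lt_neqAle eq_sym rn0.
have r2 : r%:~R / P%:R < 1 :> R.
  by rewrite ltr_pdivrMr// mul1r -[P%:R]/(P%:Z%:~R) ltr_int.
apply: lt_le_trans (sin_pi_ge _); last by rewrite !ltW.
by rewrite lt_min r1 subr_gt0.
Qed.


End Trig.

(** Families of integers symmetric under a change of sign: their sine sums vanish, so that
    real cosine sums multiply like exponential sums. *)
Definition odd_family (I : finType) (u : I -> int) :=
  exists2 r : I -> I, injective r & forall i, u (r i) = - u i.

(** * Orthogonality *)

Section Orthogonality.
Variable R : realType.
Variable P : nat.
Hypothesis P0 : (0 < P)%N.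

Lemma sum_cos_angle k :
  \sum_(a < P) cos (a%:R * angle R P k) = P%:R * (P%:Z %| k)%Z%:R.
Proof.
have [/dvdzP[l ->]|Pk] := boolP (P%:Z %| k)%Z.
  rewrite mulr1 mulrC angle_period//.
  rewrite (eq_bigr (fun=> 1)) ?sumr_const ?card_ord// => a _.
  rewrite mulrA -[a%:R]/((a%:Z)%:~R) -intrM -[X in cos X]add0r.
  by rewrite cos_add_2pi_int cos0.
rewrite mulr0; have s0 := sin_half_angle_neq0 R P0 Pk.
have := sum_cos_telescope P 0 (angle R P k).
under eq_bigr do rewrite subr0.
rewrite -mulr_suml subr0 add0r mulrBl (_ : P%:R * _ = k%:~R * (pi *+ 2)); last first.
  by rewrite -[P%:R]/((P%:Z)%:~R) angleM angle_period.
rewrite addrC [X in _ = _ + sin X]addrC sin_add_2pi_int sinN.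
rewrite [1 / 2 * _]mulrC mul1r addrN => /eqP.
by rewrite !mulf_eq0 (negbTE s0) pnatr_eq0/= orbF => /eqP.
Qed.

Lemma sum_sin_angle k : \sum_(a < P) sin (a%:R * angle R P k) = 0.
Proof.
have [/dvdzP[l ->]|Pk] := boolP (P%:Z %| k)%Z.
  rewrite mulrC angle_period//; apply: big1 => a _.
  rewrite mulrA -[a%:R]/((a%:Z)%:~R) -intrM -[X in sin X]add0r.
  by rewrite sin_add_2pi_int sin0.
have s0 := sin_half_angle_neq0 R P0 Pk.
have := sum_sin_telescope P (angle R P k).
rewrite -mulr_suml mulrBl (_ : P%:R * _ = k%:~R * (pi *+ 2)); last first.
  by rewrite -[P%:R]/((P%:Z)%:~R) angleM angle_period.
rewrite [X in _ = _ - cos X]addrC cos_add_2pi_int cosN.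
rewrite [1 / 2 * _]mulrC mul1r subrr => /eqP.
by rewrite !mulf_eq0 (negbTE s0) pnatr_eq0/= orbF => /eqP.
Qed.

Definition cos_sum (I : finType) (u : I -> int) (a : int) : R :=
  \sum_i cos (angle R P (u i * a)).

Lemma odd_sin (I : finType) (u : I -> int) a : odd_family u ->
  \sum_i sin (angle R P (u i * a)) = 0.
Proof.
move=> [r ri ur]; set s := \sum_i _.
have : s = - s.
  rewrite -sumrN /s (reindex_inj ri)/=; apply: eq_bigr => i _.
  by rewrite ur mulNr angleN sinN.
by move=> h; lra.
Qed.

(** Expanding the cosine of a sum, every term that contains a sine is killed by the symmetry
    of u or v; the product is then a sum of cosines, to which orthogonality applies. *)
Lemma sum_cos_sum3 (I J K : finType) (u : I -> int) (v : J -> int) (w : K -> int) :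
  odd_family u -> odd_family v ->
  \sum_(a < P) cos_sum u a * cos_sum v a * cos_sum w a =
  P%:R * (\sum_i \sum_j \sum_k (P%:Z %| (u i + v j + w k)%R)%Z)%:R.
Proof.
move=> ou ov.
transitivity (\sum_i \sum_j \sum_k \sum_(a < P)
    cos (a%:R * angle R P (u i + v j + w k)) : R); last first.
  rewrite natr_sum mulr_sumr; apply: eq_bigr => i _.
  rewrite natr_sum mulr_sumr; apply: eq_bigr => j _.
  by rewrite natr_sum mulr_sumr; apply: eq_bigr => k _; rewrite sum_cos_angle.
under [RHS]eq_bigr => i _ do under eq_bigr => j _ do rewrite exchange_big/=.
under [RHS]eq_bigr => i _ do rewrite exchange_big/=.
rewrite [RHS]exchange_big/=; apply: eq_bigr => a _.
have E x : a%:R * angle R P x = angle R P (x * a).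
  by rewrite -[a%:R]/((a%:Z)%:~R) angleM mulrC.
have c2 : \sum_i \sum_j cos (angle R P ((u i + v j) * a)) = cos_sum u a * cos_sum v a.
  rewrite /cos_sum big_distrl/=.
  transitivity (\sum_i (cos (angle R P (u i * a)) * \sum_j cos (angle R P (v j * a))
     - sin (angle R P (u i * a)) * \sum_j sin (angle R P (v j * a)))).
    apply: eq_bigr => i _; rewrite !mulr_sumr -sumrB; apply: eq_bigr => j _.
    by rewrite mulrDl angleD cosD.
  by rewrite odd_sin//; apply: eq_bigr => i _; rewrite mulr0 subr0.
have s2 : \sum_i \sum_j sin (angle R P ((u i + v j) * a)) = 0.
  transitivity (\sum_i (sin (angle R P (u i * a)) * \sum_j cos (angle R P (v j * a))
     + cos (angle R P (u i * a)) * \sum_j sin (angle R P (v j * a)))).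
    apply: eq_bigr => i _; rewrite !mulr_sumr -big_split/=; apply: eq_bigr => j _.
    by rewrite mulrDl angleD sinD.
  by rewrite big_split/= -!mulr_suml odd_sin// odd_sin// mul0r mulr0 addr0.
transitivity (\sum_i \sum_j (cos (angle R P ((u i + v j) * a)) * cos_sum w a
   - sin (angle R P ((u i + v j) * a)) * \sum_k sin (angle R P (w k * a)))); last first.
  apply: eq_bigr => i _; apply: eq_bigr => j _.
  rewrite /cos_sum !mulr_sumr -sumrB; apply: eq_bigr => k _.
  by rewrite E [X in _ = cos (angle _ _ X)]mulrDl angleD cosD.
under [RHS]eq_bigr => i _ do rewrite sumrB -!mulr_suml.
by rewrite sumrB -!mulr_suml c2 s2 mul0r subr0.
Qed.

Lemma sum_cos_sum2 (I J : finType) (u : I -> int) (v : J -> int) :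
  odd_family u -> odd_family v ->
  \sum_(a < P) cos_sum u a * cos_sum v a =
  P%:R * (\sum_i \sum_j (P%:Z %| (u i + v j)%R)%Z)%:R.
Proof.
move=> ou ov.
transitivity (\sum_(a < P) cos_sum u a%:Z * cos_sum v a%:Z * cos_sum (fun _ : 'I_1 => 0) a%:Z).
  by apply: eq_bigr => a _; rewrite [X in _ = _ * X]big_ord1 mul0r /angle !mul0r cos0 mulr1.
rewrite sum_cos_sum3//; congr (_ * _%:R).
by apply: eq_bigr => i _; apply: eq_bigr => j _; rewrite big_ord1 addr0.
Qed.

Lemma sum_period_shift (F : int -> R) (k : int) :
  (forall j, F (j + P%:Z) = F j) ->
  \sum_(a < P) F (a%:Z + k) = \sum_(a < P) F a%:Z.
Proof.
move=> FP.
have S j : \sum_(a < P) F (a%:Z + (j + 1)) = \sum_(a < P) F (a%:Z + j).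
  case: P P0 FP => [//|p] _ FP.
  rewrite big_ord_recr [RHS]big_ord_recl/= addrC; congr (_ + _).
    by rewrite addrCA (_ : _ + 1 = p.+1%:Z) ?FP ?add0r//; lia.
  by apply: eq_bigr => i _; congr F; rewrite /bump/=; lia.
have N n : \sum_(a < P) F (a%:Z + n%:Z) = \sum_(a < P) F a%:Z.
  elim: n => [|n IH]; first by under eq_bigr do rewrite addr0.
  by rewrite -IH -(S n); apply: eq_bigr => a _; congr F; lia.
case: k => n; first exact: N.
have N' n' : \sum_(a < P) F (a%:Z - n'%:Z) = \sum_(a < P) F a%:Z.
  elim: n' => [|m IH]; first by under eq_bigr do rewrite subr0.
  by rewrite -IH -(S (- m.+1%:Z)); apply: eq_bigr => a _; congr F; lia.
by rewrite -(N' n.+1); apply: eq_bigr => a _; congr F; lia.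
Qed.

End Orthogonality.

(** * The dilation identity *)

Section Families.
Variable R : realType.

(** The symmetric progression -Nx, ..., -x, 0, x, ..., Nx. *)
Definition sprog (N x : nat) (i : 'I_(N.*2.+1)) : int := (i%:Z - N%:Z) * x%:Z.

Lemma sprog_odd N x : odd_family (@sprog N x).
Proof.
exists (@rev_ord _); first exact: rev_ord_inj.
by move=> i; rewrite /sprog/=; have := ltn_ord i; nia.
Qed.

Lemma dirichlet_cos_sum P N x a :
  dirichlet N (x%:R * angle R P a) = cos_sum R P (@sprog N x) a.
Proof.
apply: eq_bigr => i _; congr cos.
rewrite -[x%:R]/((x%:Z)%:~R) -[i%:R]/((i%:Z)%:~R) -[N%:R]/((N%:Z)%:~R) -intrB.
by rewrite !angleM mulrA.
Qed.

Lemma dirichlet_period P N a k : (0 < P)%N ->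
  dirichlet N (angle R P (a + P%:Z * k)) = dirichlet N (angle R P a).
Proof.
move=> P0; apply: eq_bigr => i _.
rewrite -[i%:R]/((i%:Z)%:~R) -[N%:R]/((N%:Z)%:~R) -intrB !angleM mulrDr.
by rewrite mulrCA cos_angle_period.
Qed.

Lemma sum_dvd_from0 (V : nmodType) q n (F : nat -> V) : (0 < q)%N ->
  \sum_(c < n.+1 | (q %| c)%N) F c = \sum_(u < (n %/ q).+1) F (q * u)%N.
Proof.
move=> q0; rewrite -(big_mkord (fun c => q %| c)%N) -(big_mkord xpredT (fun u => F (q * u)%N)).
rewrite big_ltn_cond// dvdn0 [RHS]big_ltn// muln0.
by congr (_ + _); apply: sum_dvd_from1.
Qed.

Lemma sum_multiples (V : nmodType) p x (F : nat -> V) : (0 < p)%N -> (0 < x)%N ->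
  \sum_(c < p * x | (p * x %| c * x)%N) F c = \sum_(b < x) F (p * b)%N.
Proof.
move=> p0 x0; have P0 : (0 < p * x)%N by rewrite muln_gt0 p0.
have Pc : (((p * x).-1 %/ p).+1 = x)%N.
  have -> : ((p * x).-1 = x.-1 * p + p.-1)%N by nia.
  by rewrite divnMDl// divn_small ?addn0 ?prednK.
rewrite -(big_mkord (fun c => p * x %| c * x)%N F).
rewrite -[X in index_iota 0 X](prednK P0) big_mkord.
rewrite (eq_bigl (fun c : 'I_(p * x).-1.+1 => p %| c)%N); last first.
  by move=> c; rewrite dvdn_pmul2r.
by rewrite sum_dvd_from0// Pc.
Qed.

(** Averaging over the fractions b/x keeps exactly those frequencies of the longer kernel that
    are divisible by x.  The fractions b/x are the c/P with P | c x. *)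
Lemma dirichlet_dilate P m x a : (0 < P)%N -> (0 < x)%N -> (x %| P)%N ->
  x%:R * dirichlet m (x%:R * angle R P a) =
  \sum_(c < P | (P %| c * x)%N) dirichlet (x * m) (angle R P (a - c%:Z)).
Proof.
move=> P0 x0 /dvdnP[p PE].
have p0 : (0 < p)%N by move: P0; rewrite PE muln_gt0 => /andP[].
subst P; rewrite (sum_multiples (fun c => dirichlet (x * m) (angle R (p * x) (a - c%:Z))))//.
rewrite /dirichlet exchange_big/=.
have E i : \sum_(b < x) cos ((i%:R - (x * m)%:R) * angle R (p * x) (a - (p * b)%N%:Z)) =
   (x %| i)%N%:R * (x%:R * cos ((i%:R - (x * m)%:R) * angle R (p * x) a)).
  set z : int := i%:Z - (x * m)%N%:Z.
  have zE : i%:R - (x * m)%:R = z%:~R :> R by rewrite intrB.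
  have xz : (x%:Z %| z)%Z = (x %| i)%N.
    transitivity (x%:Z %| (i : nat)%:Z)%Z => //.
    by apply: rpredBr; rewrite PoszM dvdz_mulr.
  rewrite zE -xz.
  transitivity (cos (z%:~R * angle R (p * x) a) * \sum_(b < x) cos (b%:R * angle R x z)
    + sin (z%:~R * angle R (p * x) a) * \sum_(b < x) sin (b%:R * angle R x z)).
    rewrite !mulr_sumr -big_split/=; apply: eq_bigr => b _.
    rewrite angleD mulrDr angleN mulrN (_ : z%:~R * angle R (p * x) (p * b)%N = b%:R * angle R x z).
      by rewrite cosB.
    have x0' : 0 < x%:R :> R by rewrite ltr0n.
    have p0' : 0 < p%:R :> R by rewrite ltr0n.
    rewrite /angle natrM -[(p * b)%N%:~R]/((p * b)%:R) natrM mulr2n; field; posne.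
  by rewrite sum_cos_angle// sum_sin_angle// mulr0 addr0; ring.
under [RHS]eq_bigr => i _ do rewrite E.
transitivity (\sum_(i < (x * m).*2.+1 | (x %| i)%N) x%:R * cos ((i%:R - (x * m)%:R) * angle R (p * x) a)); last first.
  by rewrite big_mkcond/=; apply: eq_bigr => i _; case: ifP; rewrite ?mul1r ?mul0r.
rewrite (sum_dvd_from0 _ (fun i => x%:R * cos ((i%:R - (x * m)%:R) * angle R (p * x) a)))//.
have -> : ((x * m).*2 %/ x)%N = m.*2 by rewrite -muln2 -mulnA mulKn// muln2.
rewrite mulr_sumr; apply: eq_bigr => j _.
by congr (_ * cos _); rewrite !natrM; ring.
Qed.

End Families.

(** Pigeonhole on the Q + 1 residues of a i modulo P, sorted into Q intervals of length P/Q;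
    dividing q and u by their gcd only improves the approximation. *)
Lemma dirichlet_approx (a P Q : nat) : (0 < P)%N -> (0 < Q)%N ->
  exists q u : nat, [/\ (0 < q)%N, (q <= Q)%N, coprime u q &
    `|(a * q)%N%:Z - (u * P)%N%:Z| * Q%:Z <= P%:Z].
Proof.
move=> P0 Q0.
have fQ (i : 'I_Q.+1) : (((a * i) %% P * Q) %/ P < Q)%N.
  by rewrite ltn_divLR// mulnC ltn_pmul2l// ltn_mod.
pose f i := Ordinal (fQ i).
have /injectivePn[i [j ij /(congr1 val)/= fij]] : ~~ injectiveb f.
  by apply/negP => /injectiveP/leq_card; rewrite !card_ord ltnn.
wlog ltij : i j ij fij / (i < j)%N => [wl|].
  have [ji|ji|ji] := ltngtP i j; first exact: (wl i j).
    by apply: (wl j i); rewrite // eq_sym.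
  by move: ij; rewrite (val_inj ji) eqxx.
pose q0 := (j - i)%N; pose u0 := ((a * j) %/ P - (a * i) %/ P)%N.
have q00 : (0 < q0)%N by rewrite subn_gt0.
have h0 : `|(a * q0)%N%:Z - (u0 * P)%N%:Z| * Q%:Z <= P%:Z.
  have hu : ((a * i) %/ P <= (a * j) %/ P)%N.
    by rewrite leq_div2r// leq_mul2l (ltnW ltij) orbT.
  have ei := divn_eq (a * i) P; have ej := divn_eq (a * j) P.
  have -> : (a * q0)%N%:Z - (u0 * P)%N%:Z = ((a * j) %% P)%N%:Z - ((a * i) %% P)%N%:Z.
    rewrite /q0 /u0 mulnBr mulnBl.
    have := leq_mul hu (leqnn P).
    have : (a * i <= a * j)%N by rewrite leq_mul2l (ltnW ltij) orbT.
    by lia.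
  have di := divn_eq ((a * i) %% P * Q) P; have dj := divn_eq ((a * j) %% P * Q) P.
  have mi : (((a * i) %% P * Q) %% P < P)%N by rewrite ltn_mod.
  have mj : (((a * j) %% P * Q) %% P < P)%N by rewrite ltn_mod.
  move: di dj mi mj; rewrite fij.
  move: ((a * i) %% P)%N ((a * j) %% P)%N => x y.
  move: (_ %/ P * P)%N ((x * Q) %% P)%N ((y * Q) %% P)%N => z s t.
  by move=> hx hy sP tP; rewrite -[Q%:Z]ger0_norm// -normrM mulrBl; lia.
pose g := gcdn u0 q0.
have g0 : (0 < g)%N by rewrite gcdn_gt0 q00 orbT.
have uE : u0 = (u0 %/ g * g)%N by rewrite divnK ?dvdn_gcdl.
have qE : q0 = (q0 %/ g * g)%N by rewrite divnK ?dvdn_gcdr.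
exists (q0 %/ g)%N, (u0 %/ g)%N; split.
- by rewrite divn_gt0// dvdn_leq ?dvdn_gcdr.
- apply: leq_trans (leq_div _ _) _; rewrite /q0.
  by have := ltn_ord j; lia.
- by rewrite /coprime -(eqn_pmul2r g0) mul1n muln_gcdl -uE -qE.
- move: h0; rewrite {1}uE {1}qE !mulnA mulnAC.
  rewrite (_ : _ - _ = ((a * (q0 %/ g))%N%:Z - (u0 %/ g * P)%N%:Z) * g%:Z); last by lia.
  rewrite normrM => h; apply: le_trans h.
  by rewrite ler_wpM2r// ler_peMr//; lia.
Qed.

(** * Sums of kernels over the fractions with a given denominator *)

Section KernelBounds.
Variable R : realType.

Lemma sum_inv_reflect n : \sum_(1 <= r < n) (r%:R^-1 + (n - r)%:R^-1) <= 2 * harm R n.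
Proof.
case: n => [|n]; first by rewrite big_geq// mulr_ge0// harm_ge0.
rewrite big_split/= [X in _ + X]big_nat_rev/=.
rewrite [X in _ + X](_ : _ = harm R n); last first.
  by apply: eq_big_nat => k /andP[k0 kn]; congr (_%:R^-1); lia.
rewrite -/(harm R n) -mulr2n mulr_natl lerMn2r/=.
exact: harm_homo.
Qed.

Lemma harm_double n : (0 < n)%N -> harm R n.*2 <= 2 * harm R n.
Proof.
move=> n0; have h1 := harm_ge1 R n0.
suff : harm R n.*2 <= harm R n + 1 by lra.
rewrite /harm (big_cat_nat _ (n := n.+1))//=; last by rewrite ltnS -addnn leq_addr.
rewrite lerD2l.
apply: (@le_trans _ _ (\sum_(n.+1 <= k < n.*2.+1) n%:R^-1)).
  apply: ler_sum_nat => k /andP[nk _]; rewrite lef_pV2 ?posrE ?ltr0n ?ler_nat//; lia.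
rewrite sumr_const_nat (_ : n.*2.+1 - n.+1 = n)%N; last by lia.
by rewrite -[leLHS]mulr_natl divff// pnatr_eq0 -lt0n.
Qed.

(** Half of the angle is pi y/x, so the kernel is at most the inverse of the distance of y/x to
    the integers, which is x times one of the two terms on the right. *)
Lemma kernel_bound p x N (y : R) (a : int) : (0 < p)%N -> (0 < x)%N ->
  a%:~R = p%:R * y -> 0 < `|y| < x%:R ->
  x%:R^-1 * `|dirichlet N (angle R (p * x) a)| <= `|y|^-1 + (x%:R - `|y|)^-1.
Proof.
move=> p0 x0 ay /andP[y0 yx].
have x0' : 0 < x%:R :> R by rewrite ltr0n.
have p0' : 0 < p%:R :> R by rewrite ltr0n.
pose z := `|y| / x%:R.
have z0 : 0 < z by rewrite divr_gt0.
have z1 : z < 1 by rewrite ltr_pdivrMr// mul1r.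
have sz : `|sin (angle R (p * x) a / 2)| = `|sin (pi * z)|.
  have -> : angle R (p * x) a / 2 = pi * (y / x%:R).
    by rewrite /angle ay natrM mulr2n; field; posne.
  rewrite /z; have [yy|yy] := lerP 0 y; first by rewrite (ger0_norm yy).
  by rewrite (ltr0_norm yy) mulNr mulrN sinN normrN.
have z01 : 0 <= z <= 1 by rewrite !ltW.
have hs := sin_pi_ge z01.
have s0 : 0 < sin (pi * z) by apply: lt_le_trans hs; rewrite lt_min z0 subr_gt0.
have := dirichlet_bound N (angle R (p * x) a); rewrite sz (gtr0_norm s0) => hD.
have hD' : `|dirichlet N (angle R (p * x) a)| <= (sin (pi * z))^-1.
  by rewrite -[leRHS]div1r ler_pdivlMr.
have hm : (sin (pi * z))^-1 <= z^-1 + (1 - z)^-1.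
  have z10 : 0 < 1 - z by rewrite subr_gt0.
  have zi : 0 < z^-1 by rewrite invr_gt0.
  have zi' : 0 < (1 - z)^-1 by rewrite invr_gt0.
  move: hs; rewrite ge_min => /orP[hs|hs].
    apply: (@le_trans _ _ z^-1); last by lra.
    by rewrite lef_pV2.
  apply: (@le_trans _ _ (1 - z)^-1); last by lra.
  by rewrite lef_pV2.
rewrite ler_pdivrMl// (le_trans (le_trans hD' hm))// /z mulrDr.
rewrite le_eqVlt; apply/orP; left; apply/eqP.
have := subr_gt0 `|y| x%:R; rewrite yx => xy.
by field; posne.
Qed.

(** Here alpha = a/(p x), so a/p = x alpha, and b0 is an integer next to it.  The fractions
    b/x with b away from b0 lie at distances at least (j - 1/2)/x from alpha on either
    side, which gives a harmonic sum. *)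
Lemma far_fractions_sum p x N (a b0 : int) : (0 < p)%N -> (0 < x)%N ->
  `|a%:~R / p%:R - b0%:~R| <= 1 / 2 :> R ->
  \sum_(b < x | ~~ (x%:Z %| (b%:Z - b0)%R)%Z)
     x%:R^-1 * `|dirichlet N (angle R (p * x) (a - p%:Z * b%:Z))| <= 4 * harm R x.
Proof.
case: x => [//|x] p0 x0 hd; rewrite big_mkcond/=.
have p0' : 0 < p%:R :> R by rewrite ltr0n.
pose F (b : int) : R := if ~~ (x.+1%:Z %| (b - b0)%R)%Z then
     x.+1%:R^-1 * `|dirichlet N (angle R (p * x.+1) (a - p%:Z * b))| else 0.
have FP j : F (j + x.+1%:Z) = F j.
  rewrite /F -addrAC; have -> : (x.+1%:Z %| (j - b0 + x.+1%:Z)%R)%Z = (x.+1%:Z %| (j - b0)%R)%Z.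
    by apply: rpredDr; rewrite dvdzz.
  rewrite (_ : a - _ * (j + _) = a - p%:Z * j + (p * x.+1)%N%:Z * -1); last by lia.
  by rewrite dirichlet_period// muln_gt0 p0.
rewrite -(sum_period_shift x0 b0 FP).
rewrite big_ord_recl.
rewrite {1}/F/= add0r subrr dvdz0/= add0r.
apply: (@le_trans _ _ (\sum_(1 <= r < x.+1) 2 * (r%:R^-1 + (x.+1 - r)%:R^-1))); last first.
  by rewrite -mulr_sumr (_ : 4 = 2 * 2 :> R) -?mulrA ?ler_wpM2l ?sum_inv_reflect//; lra.
rewrite big_add1/= big_mkord; apply: ler_sum => i _.
rewrite /F; case: ifP => _; last by rewrite mulr_ge0// addr_ge0// invr_ge0.
set d := _ / _ - _ in hd.
have jE : (bump 0 i)%:R = i%:R + 1 :> R by rewrite natr1.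
have ix : i%:R + 1 <= x%:R :> R by rewrite natr1 ler_nat ltn_ord.
have i0 := ler0n R i.
pose y := d - (i%:R + 1).
have yE : `|y| = i%:R + 1 - d by rewrite ler0_norm /y; move: hd; rewrite ler_norml; lra.
have := @kernel_bound p x.+1 N y (a - p%:Z * ((bump 0 i)%:Z + b0)) p0 isT.
rewrite yE => h; apply: le_trans (h _ _) _.
- rewrite intrD mulrNz intrM intrD -[p%:~R]/(p%:R) -[(bump 0 i)%:~R]/((bump 0 i)%:R) jE.
  by rewrite /y /d; field; posne.
- by move: hd; rewrite ler_norml -(natr1 x) => /andP[h1 h2]; apply/andP; split; lra.
have E (s t : R) : 1 <= s -> s - 1 / 2 <= t -> t^-1 <= 2 * s^-1.
  move=> s1 st; rewrite -[2]invrK -invfM lef_pV2 ?posrE; lra.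
rewrite mulrDr lerD//; apply: E.
- by rewrite -natr1; lra.
- by move: hd; rewrite ler_norml -?natr1; lra.
- by rewrite natrB ?ltnS 1?ltnW// -?natr1; lra.
- by rewrite natrB ?ltnS 1?ltnW//; move: hd; rewrite ler_norml -?natr1; lra.
Qed.

End KernelBounds.

(** * Concentration on a single fraction *)

Section FareyArcs.
Variable R : realType.

(** Only one residue b is congruent to b0, and its fraction lies at distance |a/p - b0|/x. *)
Lemma near_fraction_sum p x N (a b0 : int) : (0 < p)%N -> (0 < x)%N ->
  0 < `|a%:~R / p%:R - b0%:~R : R| <= 1 / 2 ->
  \sum_(b < x | (x%:Z %| (b%:Z - b0)%R)%Z)
     x%:R^-1 * `|dirichlet N (angle R (p * x) (a - p%:Z * b%:Z))|
   <= 2 / `|a%:~R / p%:R - b0%:~R|.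
Proof.
case: x => [//|x] p0 x0 /andP[d0 d1]; rewrite big_mkcond/=.
have p0' : 0 < p%:R :> R by rewrite ltr0n.
pose F (b : int) : R := if (x.+1%:Z %| (b - b0)%R)%Z then
     x.+1%:R^-1 * `|dirichlet N (angle R (p * x.+1) (a - p%:Z * b))| else 0.
have FP j : F (j + x.+1%:Z) = F j.
  rewrite /F -addrAC; have -> : (x.+1%:Z %| (j - b0 + x.+1%:Z)%R)%Z = (x.+1%:Z %| (j - b0)%R)%Z.
    by apply: rpredDr; rewrite dvdzz.
  rewrite (_ : a - _ * (j + _) = a - p%:Z * j + (p * x.+1)%N%:Z * -1); last by lia.
  by rewrite dirichlet_period// muln_gt0 p0.
rewrite -(sum_period_shift x0 b0 FP).
rewrite big_ord_recl [X in _ + X]big1 ?addr0; last first.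
  move=> i _; rewrite /F addrK; case: ifP => // /dvdnP[[|k]]; first by rewrite mul0n.
  by rewrite /= => h; have := ltn_ord i; rewrite /bump in h; move: h; nia.
rewrite {1}/F/= add0r subrr dvdz0.
set d := _ - _ in d0 d1 *.
have x1 : 1 <= x.+1%:R :> R by rewrite ler1n.
apply: le_trans (@kernel_bound R p x.+1 N d (a - p%:Z * b0) p0 isT _ _) _.
- by rewrite intrD mulrNz intrM -[p%:~R]/(p%:R) /d; field; posne.
- by apply/andP; split => //; lra.
rewrite mulrDl mul1r lerD2l lef_pV2 ?posrE; lra.
Qed.

Lemma fraction_sum_split p x N (a b0 : int) (c0 : nat) : (0 < p)%N -> (0 < x)%N ->
  \sum_(c < p * x | (p * x %| c * x)%N)
     (if c != c0 :> nat then x%:R^-1 * `|dirichlet N (angle R (p * x) (a - c%:Z))| else 0)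
  = \sum_(b < x | ~~ (x%:Z %| (b%:Z - b0)%R)%Z)
     (if (p * b != c0)%N then x%:R^-1 * `|dirichlet N (angle R (p * x) (a - p%:Z * b%:Z))| else 0) +
   \sum_(b < x | (x%:Z %| (b%:Z - b0)%R)%Z)
     (if (p * b != c0)%N then x%:R^-1 * `|dirichlet N (angle R (p * x) (a - p%:Z * b%:Z))| else 0).
Proof.
move=> p0 x0.
rewrite (sum_multiples (fun c : nat => if c != c0 :> nat then
  x%:R^-1 * `|dirichlet N (angle R (p * x) (a - c%:Z))| else 0))//.
by rewrite (bigID (fun b : 'I_x => (x%:Z %| (b%:Z - b0)%R)%Z))/= addrC.
Qed.

(** When the excluded index c0 is the fraction b0/x itself, the near term disappears. *)
Lemma fraction_sum_center_removed p x N (a b0 : int) (c0 : nat) : (0 < p)%N -> (0 < x)%N ->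
  `|a%:~R / p%:R - b0%:~R : R| <= 1 / 2 ->
  (c0 < p * x)%N -> ((p * x)%N%:Z %| (c0%:Z - p%:Z * b0)%R)%Z ->
  \sum_(c < p * x | (p * x %| c * x)%N)
     (if c != c0 :> nat then x%:R^-1 * `|dirichlet N (angle R (p * x) (a - c%:Z))| else 0)
  <= 4 * harm R x.
Proof.
move=> p0 x0 hd c0P hc; rewrite (fraction_sum_split _ _ b0)//.
rewrite [X in _ + X]big1 ?addr0; last first.
  move=> b xb; rewrite ifF//; apply/negbTE; rewrite negbK; apply/eqP.
  have h : ((p * x)%N%:Z %| (p * b)%N%:Z - c0%:Z)%Z.
    rewrite (_ : _ - _ = p%:Z * (b%:Z - b0) - (c0%:Z - p%:Z * b0)); last by lia.
    by apply: rpredB => //; rewrite PoszM dvdz_mul ?dvdzz.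
  have := ltn_ord b => bx.
  have pbP : (p * b < p * x)%N by rewrite ltn_pmul2l.
  move: h => /dvdzP[k]; move: pbP c0P; move: (p * x)%N (p * b)%N => P y yP cP.
  by case: k => [[|k]|k]; nia.
apply: le_trans (far_fractions_sum N p0 x0 hd).
by apply: ler_sum => b _; case: ifP => // _; rewrite mulr_ge0// invr_ge0.
Qed.

Lemma fraction_sum_all p x N (a b0 : int) (c0 : nat) : (0 < p)%N -> (0 < x)%N ->
  0 < `|a%:~R / p%:R - b0%:~R : R| <= 1 / 2 ->
  \sum_(c < p * x | (p * x %| c * x)%N)
     (if c != c0 :> nat then x%:R^-1 * `|dirichlet N (angle R (p * x) (a - c%:Z))| else 0)
  <= 4 * harm R x + 2 / `|a%:~R / p%:R - b0%:~R|.
Proof.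
move=> p0 x0 hd; have /andP[_ hd1] := hd; rewrite (fraction_sum_split _ _ b0)//.
have h b : 0 <= x%:R^-1 * `|dirichlet N (angle R (p * x) (a - p%:Z * b%:Z))|.
  by rewrite mulr_ge0// invr_ge0.
apply: lerD.
  apply: le_trans (far_fractions_sum N p0 x0 hd1).
  by apply: ler_sum => b _; case: ifP.
apply: le_trans (near_fraction_sum N p0 x0 hd).
by apply: ler_sum => b _; case: ifP.
Qed.

(** A bound for the near term, in terms of the residue r of u x modulo q.  The value 0 at r = 0
    belongs to the multiples x of q, where the near term is the excluded one. *)
Definition residue_weight (q r : nat) : R :=
  if r == 0%N then 0 else 4 * q%:R * (r%:R^-1 + (q - r)%:R^-1).

(** r/q keeps distance at least min(r, q - r)/q from the integers, and a perturbation of size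
    1/(2q) uses up at most half of it. *)
Lemma fraction_gap (q r k : nat) (b : int) (y : R) : (0 < r)%N -> (r < q)%N ->
  `|y - (k%:R + r%:R / q%:R)| <= q%:R^-1 / 2 ->
  0 < `|y - b%:~R| /\ 2 / `|y - b%:~R| <= residue_weight q r.
Proof.
move=> r0 rq hy; rewrite /residue_weight gtn_eqF// natrB ?(ltnW rq)//.
have r1 : 1 <= r%:R :> R by rewrite ler1n.
have rq1 : 1 <= q%:R - r%:R :> R by rewrite -natrB ?ler1n ?subn_gt0// ltnW.
have kb : b%:~R <= k%:R :> R \/ k%:R + 1 <= b%:~R :> R.
  have [kb|kb] := lerP b k%:Z; [left|right].
    by rewrite -[k%:R]/((k%:Z)%:~R) ler_int.
  by rewrite natr1 -[k.+1%:R]/((k.+1%:Z)%:~R) ler_int intS lez1D.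
move: (q%:R) (r%:R) (k%:R) (b%:~R : R) hy r1 rq1 kb => {r0 rq}Q {}r {}k {}b hy r1 rq1 kb.
have e1 : 0 <= (r - 1) / Q by rewrite divr_ge0//; lra.
have e2 : 0 <= (Q - r - 1) / Q by rewrite divr_ge0//; lra.
have rE : r / Q = Q^-1 + (r - 1) / Q by field; posne.
have QrE : 1 - r / Q = Q^-1 + (Q - r - 1) / Q by field; posne.
have QrE' : (Q - r) / Q = 1 - r / Q by field; posne.
have key : r / Q / 2 <= `|y - b| \/ (Q - r) / Q / 2 <= `|y - b|.
  case: kb => kb; [left|right].
    by apply: le_trans (ler_norm _); move: hy; rewrite ler_norml; lra.
  rewrite -normrN; apply: le_trans (ler_norm _).
  by move: hy; rewrite ler_norml; lra.
have d0 : 0 < `|y - b|.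
  have : 0 < r / Q / 2 by rewrite !divr_gt0//; lra.
  have : 0 < (Q - r) / Q / 2 by rewrite !divr_gt0//; lra.
  by case: key; lra.
split=> //; have Q4 : 0 <= 4 * Q by lra.
have i1 : 0 <= r^-1 by rewrite invr_ge0; lra.
have i2 : 0 <= (Q - r)^-1 by rewrite invr_ge0; lra.
have mono z : 1 <= z -> z / Q / 2 <= `|y - b| -> 2 / `|y - b| <= 4 * Q * z^-1.
  move=> z0 hz; rewrite ler_pdivrMr//.
  rewrite (_ : 2 = 4 * Q * z^-1 * (z / Q / 2)); last by field; posne.
  by rewrite ler_wpM2l// mulr_ge0// invr_ge0; lra.
by case: key => /mono h; apply: le_trans (h _) _ => //; rewrite ler_wpM2l//; lra.
Qed.

(** As u is prime to q, each block of q consecutive x runs over all residues once and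
    contributes O(q log q); there are n/q + 1 blocks and q = O(n). *)
Lemma sum_residue_weight n u q : (0 < q)%N -> coprime u q -> (q <= n.*2)%N ->
  \sum_(1 <= x < n.+1) residue_weight q ((u * x) %% q) <= 24 * (n%:R * harm R n.*2).
Proof.
move=> q0 uq qn.
have wm x : 0 <= residue_weight q ((u * x) %% q).
  by rewrite /residue_weight; case: ifP => // _; rewrite !mulr_ge0// addr_ge0// invr_ge0.
have per : \sum_(x < q) residue_weight q ((u * x) %% q) = \sum_(r < q) residue_weight q r.
  have fP (i : 'I_q) : ((u * i) %% q < q)%N by rewrite ltn_mod.
  rewrite [RHS](reindex_inj (h := fun i => Ordinal (fP i)))//.
  move=> i j /(congr1 val)/= /eqP h; apply/val_inj => /=.
  wlog ij : i j h / (i <= j)%N.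
    move=> wl; have [ij|/ltnW ij] := leqP i j; first exact: wl.
    by apply/esym/wl => //; rewrite eq_sym.
  move: h; rewrite eq_sym eqn_mod_dvd ?leq_mul2l ?ij ?orbT//.
  rewrite -mulnBr Gauss_dvdr; last by rewrite coprime_sym.
  move=> /dvdnP[[|k]]; first by lia.
  by have := ltn_ord j; nia.
(* one full block of residues *)
have one : \sum_(r < q) residue_weight q r <= 8 * q%:R * harm R q.
  rewrite -(big_mkord xpredT (residue_weight q)) big_ltn// {1}/residue_weight eqxx add0r.
  rewrite (_ : 8 * _ * _ = 4 * q%:R * (2 * harm R q)); last by ring.
  apply: le_trans (ler_wpM2l _ (sum_inv_reflect R q)); last by rewrite mulr_ge0.
  rewrite mulr_sumr; apply: ler_sum_nat => r /andP[r0 _].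
  by rewrite /residue_weight gtn_eqF.
have blocks K : \sum_(0 <= x < K * q) residue_weight q ((u * x) %% q) = K%:R * \sum_(r < q) residue_weight q r.
  elim: K => [|K IH]; first by rewrite big_geq// mul0r.
  rewrite (big_cat_nat _ (n := (K * q)%N))//=; last by rewrite leq_mul2r leqnSn orbT.
  rewrite IH mulSn -{1}(add0n (K * q)%N) big_addn addnK big_mkord -natr1 mulrDl mul1r.
  congr (_ + _); rewrite -per; apply: eq_bigr => i _.
  by rewrite mulnDr mulnA addnC modnMDl.
apply: (@le_trans _ _ (\sum_(0 <= x < (n %/ q).+1 * q) residue_weight q ((u * x) %% q))).
  have := ltn_ceil n q0 => h.
  rewrite [leRHS](big_cat_nat _ (n := n.+1))//= [X in _ <= X + _]big_ltn//.
  by rewrite -addrA addrCA lerDl addr_ge0 ?wm// sumr_ge0.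
rewrite blocks.
have h1 := harm_homo R qn; have hq := harm_ge0 R q.
apply: (@le_trans _ _ ((n %/ q).+1%:R * (8 * q%:R * harm R n.*2))).
  by rewrite ler_wpM2l// (le_trans one)// ler_wpM2l// mulr_ge0.
rewrite (_ : _ * _ = (((n %/ q).+1 * q)%:R) * 8 * harm R n.*2); last by rewrite natrM; ring.
rewrite (_ : 24 * _ = (3 * n)%:R * 8 * harm R n.*2); last by rewrite natrM; ring.
rewrite ler_wpM2r ?harm_ge0// ler_wpM2r// ler_nat.
by have := leq_divM n q; lia.
Qed.

Variables (n m P : nat).
Hypothesis n0 : (0 < n)%N.
Hypothesis P0 : (0 < P)%N.
Hypothesis nP : forall x, (0 < x)%N -> (x <= n)%N -> (x %| P)%N.

(** All kernels centred at the fraction c/P: those with denominator x such that x c/P is an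
    integer. *)
Definition arcsum (c : nat) (k : int) : R :=
  \sum_(1 <= x < n.+1 | (P %| c * x)%N) x%:R^-1 * dirichlet (x * m) (angle R P k).

Definition expsum (a : int) : R :=
  \sum_(1 <= x < n.+1) dirichlet m (x%:R * angle R P a).

Lemma expsum_arcsum a : expsum a = \sum_(c < P) arcsum c (a - c%:Z).
Proof.
under eq_bigr do rewrite /arcsum big_mkcond/=.
rewrite exchange_big/=; apply: eq_big_nat => x /andP[x0 xn].
have xr : x%:R != 0 :> R by rewrite pnatr_eq0 -lt0n.
apply: (mulfI xr); rewrite (dirichlet_dilate R m a P0 x0 (nP x0 xn)) mulr_sumr.
rewrite big_mkcond/=; apply: eq_bigr => c _.
by case: ifP; rewrite ?mulr0// mulVKf.
Qed.

(** If q divides x, the fraction u/q is among the b/x and equals c0/P, so that only far terms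
    remain.  Otherwise the near term is controlled by the distance of u x/q to the integers. *)
Lemma fraction_sum_bound (a : nat) (q u : nat) x (c0 : nat) :
  (0 < q)%N -> coprime u q ->
  `|(a * q)%N%:Z - (u * P)%N%:Z| * n.*2%:Z <= P%:Z ->
  c0 = ((u * (P %/ q)) %% P)%N ->
  (0 < x)%N -> (x <= n)%N ->
  \sum_(c < P | (P %| c * x)%N)
     (if c != c0 :> nat then x%:R^-1 * `|dirichlet (x * m) (angle R P (a%:Z - c%:Z))| else 0)
  <= 4 * harm R n.*2 + residue_weight q ((u * x) %% q).
Proof.
move=> q0 uq hq c0E x0 xn.
have c0P : (c0 < P)%N by rewrite c0E ltn_mod.
have /dvdnP[p PE] := nP x0 xn.
have p0 : (0 < p)%N by move: P0; rewrite PE muln_gt0 => /andP[].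
have hx : 4 * harm R x <= 4 * harm R n.*2.
  by rewrite ler_wpM2l// harm_homo// (leq_trans xn)// -addnn leq_addr.
have q0' : 0 < q%:R :> R by rewrite ltr0n.
have x0' : 0 < x%:R :> R by rewrite ltr0n.
have p0' : 0 < p%:R :> R by rewrite ltr0n.
have n0' : 0 < n%:R :> R by rewrite ltr0n.
(* a/p = x (a/P) inherits the error of a/P ~ u/q multiplied by x <= n, and that error
   is at most 1/(2nq). *)
have db : `|a%:R / p%:R - (u * x)%:R / q%:R| <= 1 / (2 * q%:R) :> R.
  have : `|a%:R * q%:R - u%:R * (p%:R * x%:R)| * (2 * n%:R) <= p%:R * x%:R :> R.
    move: hq; rewrite PE -(ler_int R) intrM intr_norm intrB -!pmulrn -muln2 !natrM.
    by rewrite (mulrC n%:R).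
  rewrite (_ : a%:R / p%:R - _ = (a%:R * q%:R - u%:R * (p%:R * x%:R)) / (p%:R * q%:R)); last first.
    by rewrite natrM; field; posne.
  rewrite normrM normfV (gtr0_norm (mulr_gt0 p0' q0')) => h.
  rewrite ler_pdivrMr ?mulr_gt0// (_ : 1 / _ * _ = p%:R / 2); last by field; posne.
  have n2 : 0 < 2 * n%:R :> R by rewrite mulr_gt0.
  rewrite -(ler_pM2r n2) (le_trans h)// (_ : _ / 2 * _ = p%:R * n%:R); last by field.
  by rewrite ler_pM2l// ler_nat.
have [qx|qx] := boolP (q %| x)%N.
  rewrite (_ : (u * x) %% q = 0)%N ?/residue_weight ?eqxx ?addr0; last first.
    by apply/eqP; rewrite -/(dvdn _ _) dvdn_mull.
  apply: le_trans hx.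
  have /dvdnP[x' xE] := qx.
  rewrite PE; apply: (@fraction_sum_center_removed p x (x * m) a%:Z (u * x')%N%:Z c0 p0 x0); last 2 first.
  - by rewrite -PE.
  - rewrite -PE c0E (_ : p%:Z * _ = (u * (P %/ q))%N%:Z); last first.
      by rewrite PE xE mulnA mulnK//; lia.
    by rewrite -eqz_mod_dvd !modz_nat modn_mod.
  - move: db; rewrite {1}xE mulnA natrM mulfK ?gt_eqF// => h; apply: (le_trans h).
    have q1 : 1 <= q%:R :> R by rewrite ler1n.
    by rewrite ler_pdivrMr ?mulr_gt0//; lra.
pose r := ((u * x) %% q)%N; pose k := ((u * x) %/ q)%N.
have rq : (r < q)%N by rewrite ltn_mod.
have uxE : (u * x)%:R / q%:R = k%:R + r%:R / q%:R :> R.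
  by rewrite [in LHS](divn_eq (u * x) q) -/r -/k natrD natrM; field; posne.
have r0 : (0 < r)%N.
  rewrite lt0n; apply: contra qx => h.
  by rewrite -(Gauss_dvdr (m := q) x (n := u)) 1?coprime_sym.
pose y : R := a%:R / p%:R.
pose b0 := Num.floor (y + 1 / 2).
have b1 : `|y - b0%:~R| <= 1 / 2.
  have /andP[] := floor_itv (y + 1 / 2); rewrite -/b0 intrD => b0l b0u.
  by rewrite ler_norml; apply/andP; split; lra.
have db' : `|y - (k%:R + r%:R / q%:R)| <= q%:R^-1 / 2.
  by move: db; rewrite uxE (_ : 1 / _ = q%:R^-1 / 2)//; field; posne.
have [d0 hd] := fraction_gap b0 r0 rq db'.
have hb : 0 < `|a%:~R / p%:R - b0%:~R : R| <= 1 / 2 by rewrite -/y d0 b1.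
rewrite PE; apply: le_trans (@fraction_sum_all p x (x * m) a%:Z b0 c0 p0 x0 hb) _.
by rewrite lerD.
Qed.

(** The distinguished fraction is the Dirichlet approximation u/q of a/P with q <= 2n.  If
    q > n then no x <= n is a multiple of q, and any choice of c0 will do. *)
Lemma off_arc_bound (a : nat) : exists c0 : 'I_P,
  \sum_(c < P | c != c0) `|arcsum c (a%:Z - c%:Z)| <= 56 * (n%:R * harm R n).
Proof.
have n20 : (0 < n.*2)%N by rewrite double_gt0.
have [q [u [q0 qn uq hq]]] := dirichlet_approx a P0 n20.
have c0P : ((u * (P %/ q)) %% P < P)%N by rewrite ltn_mod.
exists (Ordinal c0P).
have h2 := harm_double R n0.
apply: (@le_trans _ _ (28 * (n%:R * harm R n.*2))); last first.
  rewrite (_ : 56 * _ = 28 * (n%:R * (2 * harm R n))); last by ring.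
  by rewrite !ler_wpM2l.
rewrite (_ : 28 * _ = n%:R * (4 * harm R n.*2) + 24 * (n%:R * harm R n.*2)); last by ring.
rewrite -sum_const1.
apply: le_trans _ (lerD (lexx _) (sum_residue_weight q0 uq qn)).
rewrite -big_split/=.
apply: le_trans _ (ler_sum1 (fun x x0 xn => fraction_sum_bound q0 uq hq erefl x0 xn)).
under [leRHS]eq_bigr do rewrite big_mkcond/=.
rewrite exchange_big/= [leLHS]big_mkcond/=; apply: ler_sum => c _.
rewrite -val_eqE/=; case: ifP => _; last by rewrite big1// => x _; rewrite if_same.
rewrite /arcsum (le_trans (ler_norm_sum _ _ _))// [leLHS]big_mkcond/=.
apply: ler_sum_nat => x /andP[x0 _]; case: ifP => // _.
by rewrite normrM ger0_norm// invr_ge0.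
Qed.

(** With V the distinguished term, E the sum of the others and B the bound for the sum of
    their absolute values, E also controls each single term; so every product other than
    V^3 is at most B times a square, and E^2 <= 2 (V + E)^2 + 2 V^2. *)
Lemma cube_diagonal_bound (a : nat) :
  `|expsum a%:Z ^+ 3 - \sum_(c < P) arcsum c (a%:Z - c%:Z) ^+ 3| <=
   560 * (n%:R * harm R n) * (expsum a%:Z ^+ 2 + \sum_(c < P) arcsum c (a%:Z - c%:Z) ^+ 2).
Proof.
have [c0] := off_arc_bound a.
set B := 56 * _ => hB.
rewrite (_ : 560 * _ = 10 * B); last by rewrite /B; ring.
rewrite expsum_arcsum (bigD1 c0)//= [X in `|_ - X|](bigD1 c0)//= [X in _ * (_ + X)](bigD1 c0)//=.
set V := arcsum c0 _; set E := \sum_(i < P | _) arcsum i _.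
set Q3 := \sum_(i < P | _) _ ^+ 3; set Q2 := \sum_(i < P | _) _ ^+ 2.
have B0 : 0 <= B by apply: le_trans hB; apply: sumr_ge0.
have EB : `|E| <= B by apply: le_trans (ler_norm_sum _ _ _) hB.
have Wb (c : 'I_P) : c != c0 -> `|arcsum c (a%:Z - c%:Z)| <= B.
  move=> cc; apply: le_trans hB; rewrite (bigD1 c)//= lerDl.
  exact: sumr_ge0.
have Q3b : `|Q3| <= B * Q2.
  rewrite (le_trans (ler_norm_sum _ _ _))// mulr_sumr; apply: ler_sum => c cc.
  rewrite exprS normrM [X in _ * X]ger0_norm ?sqr_ge0// ler_wpM2r ?sqr_ge0//.
  exact: Wb.
have h1 : `|(V + E) ^+ 3 - V ^+ 3| <= B * (9 / 2 * V ^+ 2 + 5 / 2 * E ^+ 2).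
  rewrite (_ : _ - _ = E * (3 * V ^+ 2 + 3 * V * E + E ^+ 2)); last by ring.
  rewrite normrM; apply: ler_pM => //.
  have := sqr_ge0 (V - E); have := sqr_ge0 (V + E); have := sqr_ge0 V; have := sqr_ge0 E.
  by rewrite ler_norml => *; apply/andP; split; lra.
have h2 : E ^+ 2 <= 2 * (V + E) ^+ 2 + 2 * V ^+ 2.
  by rewrite -subr_ge0 (_ : _ - _ = (E + 2 * V) ^+ 2) ?sqr_ge0//; ring.
have -> : (V + E) ^+ 3 - (V ^+ 3 + Q3) = ((V + E) ^+ 3 - V ^+ 3) - Q3 by ring.
rewrite (le_trans (ler_normB _ _))// (le_trans (lerD h1 Q3b))//.
rewrite -mulrDr -[leRHS]mulrA [leRHS]mulrCA ler_wpM2l//.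
have Q20 : 0 <= Q2 by apply: sumr_ge0 => c _; rewrite sqr_ge0.
have := sqr_ge0 (V + E); have := sqr_ge0 V; lra.
Qed.

End FareyArcs.

Lemma dvdz_small (P : nat) (z : int) : `|z| < P%:Z -> (P%:Z %| z)%Z = (z == 0).
Proof.
move=> zP; apply/idP/eqP => [/dvdzP[k]|->]; last exact: dvdz0.
case: k => [[|k]|k]; nia.
Qed.

Lemma sprog_le N x (i : 'I_(N.*2.+1)) : `|sprog x i| <= (N * x)%N%:Z.
Proof.
rewrite /sprog normrM [ `|x%:Z|]ger0_norm// PoszM ler_wpM2r//.
by have := ltn_ord i; lia.
Qed.

(** Two solutions would differ by a nonzero multiple of y smaller than P. *)
Lemma sum_sprog_le1 (P N y : nat) (z : int) : (0 < y)%N -> (N.*2 * y < P)%N ->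
  (\sum_(j < N.*2.+1) (P%:Z %| (z + sprog y j)%R)%Z <= 1)%N.
Proof.
move=> y0 NP.
have [/existsP[j0 hj0]|/existsPn h] :=
  boolP [exists j : 'I_(N.*2.+1), (P%:Z %| (z + sprog y j)%R)%Z]; last first.
  by rewrite big1// => j _; rewrite (negbTE (h j)).
rewrite (bigD1 j0)//= hj0 big1// => j jj0.
apply/eqP; rewrite eqb0; apply: contra jj0 => hj.
have : (P%:Z %| (sprog y j - sprog y j0)%R)%Z.
  rewrite (_ : _ - _ = (z + sprog y j) - (z + sprog y j0)); last by ring.
  exact: rpredB.
have yz : 0 < y%:Z by [].
have jN := ltn_ord j; have j0N := ltn_ord j0.
have NP' : N.*2%:Z * y%:Z < P%:Z by rewrite -PoszM ltz_nat.
have E : sprog y j - sprog y j0 = (j%:Z - j0%:Z) * y%:Z by rewrite /sprog; ring.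
rewrite dvdz_small E.
  by rewrite mulf_eq0 (gt_eqF yz) orbF subr_eq0.
apply: le_lt_trans NP'; rewrite normrM [ `|y%:Z|]ger0_norm// ler_wpM2r//.
lia.
Qed.

Lemma sum_dvd_centered m d : (0 < d)%N ->
  (\sum_(i < m.*2.+1) (d%:Z %| (i%:Z - m%:Z)%R)%Z <= (m %/ d).*2.+1)%N.
Proof.
move=> d0.
rewrite -(big_mkord xpredT (fun i => nat_of_bool (d%:Z %| (i%:Z - m%:Z)%R)%Z)).
rewrite (big_cat_nat _ (n := m))//=; last by lia.
have E : (\sum_(1 <= t < m.+1) (d %| t) = m %/ d)%N.
  have := sum_dvd_from1 m (fun=> 1%N) d0; rewrite sum_nat_const_nat subn1 muln1/= => <-.
  by rewrite [RHS]big_mkcond/=; apply: eq_bigr => t _; case: ifP.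
have -> : (\sum_(0 <= i < m) (d%:Z %| (i%:Z - m%:Z)%R)%Z = m %/ d)%N.
  rewrite -E big_add1 big_nat_rev/= add0n; apply: eq_big_nat => i /andP[_ im].
  congr nat_of_bool; rewrite dvdzE; congr (_ %| _)%N; lia.
have -> : (\sum_(m <= i < m.*2.+1) (d%:Z %| (i%:Z - m%:Z)%R)%Z = (m %/ d).+1)%N.
  rewrite -{1}(add0n m) big_addn (_ : m.*2.+1 - m = m.+1)%N; last by lia.
  rewrite big_ltn// -E add0n subrr dvdz0 add1n; congr _.+1.
  by apply: eq_bigr => i _; congr nat_of_bool; rewrite PoszD addrK.
by lia.
Qed.

(** A solution of i x + j y = 0 is determined by i, which must be a multiple of y/gcd(x, y). *)
Lemma sprog_pair_le (P m x y : nat) : (0 < x)%N -> (0 < y)%N -> (m * (x + y) < P)%N ->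
  (m.*2 * y < P)%N ->
  (\sum_(i < m.*2.+1) \sum_(j < m.*2.+1) (P%:Z %| (sprog x i + sprog y j)%R)%Z
    <= (m %/ (y %/ gcdn x y)).*2.+1)%N.
Proof.
move=> x0 y0 mP yP.
have g0 : (0 < gcdn x y)%N by rewrite gcdn_gt0 x0.
have d0 : (0 < y %/ gcdn x y)%N by rewrite divn_gt0// dvdn_leq// dvdn_gcdr.
apply: leq_trans (sum_dvd_centered m d0); apply: leq_sum => i _.
have [_|/negP h] := boolP (_ %| _)%Z; first exact: sum_sprog_le1.
rewrite big1// => j _; apply/eqP; rewrite eqb0; apply/negP => hj; apply: h.
move: hj; rewrite (@dvdz_small P); last first.
  have := sprog_le x i; have := sprog_le y j; rewrite mulnDr in mP.
  move: (sprog x i) (sprog y j) (m * x)%N (m * y)%N mP => s t u v. lia.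
rewrite addr_eq0 => /eqP hb.
have : (y%:Z %| (i%:Z - m%:Z) * x%:Z)%Z.
  by rewrite -/(sprog x i) hb rpredN /sprog dvdz_mull.
rewrite !dvdzE abszM !absz_nat.
rewrite -{1}(divnK (dvdn_gcdr x y)) -{3}(divnK (dvdn_gcdl x y)) mulnA dvdn_pmul2r//.
rewrite Gauss_dvdl//.
rewrite /coprime -(eqn_pmul2r g0) mul1n muln_gcdl !divnK ?dvdn_gcdl ?dvdn_gcdr//.
by rewrite gcdnC.
Qed.

(** * Mean squares and cubes *)

Section Averages.
Variable R : realType.
Variables (n m P : nat).
Hypothesis n0 : (0 < n)%N.
Hypothesis m0 : (0 < m)%N.
Hypothesis nP : forall x, (0 < x)%N -> (x <= n)%N -> (x %| P)%N.
Hypothesis nmP : (3 * n * m < P)%N.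

Let P0 : (0 < P)%N. Proof. exact: leq_trans nmP. Qed.
Let Sa := @expsum R n m P.
Let Wa := @arcsum R n m P.

Lemma sum_expsum2 : \sum_(a < P) Sa a%:Z ^+ 2 <=
  P%:R * (n%:R ^+ 2 + 4 * m%:R * (n%:R * harm R n)).
Proof.
under eq_bigr do rewrite /Sa /expsum expr2 big_distrlr/=.
rewrite exchange_big/=; under eq_bigr do rewrite exchange_big/=.
apply: (@le_trans _ _ (\sum_(1 <= x < n.+1) \sum_(1 <= y < n.+1)
   P%:R * (1 + 2 * m%:R * ((gcdn x y)%:R / (maxn x y)%:R)))).
  apply: ler_sum1 => x x0 xn; apply: ler_sum1 => y y0 yn.
  under eq_bigr do rewrite !dirichlet_cos_sum.
  rewrite sum_cos_sum2//; try exact: sprog_odd.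
  rewrite ler_wpM2l//.
  have h z w : (0 < z)%N -> (0 < w)%N -> (z <= n)%N -> (w <= n)%N ->
    (\sum_(i < m.*2.+1) \sum_(j < m.*2.+1) (P%:Z %| (sprog z i + sprog w j)%R)%Z)%N%:R <=
    1 + 2 * m%:R * ((gcdn z w)%:R / w%:R) :> R.
    move=> z0 w0 zn wn.
    have mzw : (m * (z + w) < P)%N by nia.
    have mw : (m.*2 * w < P)%N by nia.
    have := sprog_pair_le z0 w0 mzw mw; rewrite -(ler_nat R) => /le_trans; apply.
    rewrite -natr1 -muln2 natrM addrC lerD2l mulrC -mulrA ler_wpM2l//.
    have gw : (gcdn z w %| w)%N by rewrite dvdn_gcdr.
    have g0 : (0 < gcdn z w)%N by rewrite gcdn_gt0 z0.
    have w0' : 0 < w%:R :> R by rewrite ltr0n.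
    rewrite mulrA ler_pdivlMr// -!natrM ler_nat -[X in (_ * X <= _)%N](divnK gw).
    rewrite mulnA leq_mul2r.
    by rewrite leq_divM orbT.
  have [xy|xy] := leqP x y; first exact: h.
  rewrite gcdnC exchange_big/=.
  under eq_bigr => i _ do under eq_bigr => j _ do rewrite addrC.
  exact: h.
have -> : \sum_(1 <= x < n.+1) \sum_(1 <= y < n.+1)
   P%:R * (1 + 2 * m%:R * ((gcdn x y)%:R / (maxn x y)%:R)) =
   P%:R * (n%:R ^+ 2 + 2 * m%:R * \sum_(1 <= x < n.+1) \sum_(1 <= y < n.+1)
     ((gcdn x y)%:R / (maxn x y)%:R)) :> R.
  under eq_bigr do rewrite -mulr_sumr big_split/= sum_const1 mulr1 -mulr_sumr.
  by rewrite -mulr_sumr big_split/= sum_const1 -mulr_sumr expr2.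
rewrite ler_wpM2l// lerD2l (_ : 4 * _ * _ = 2 * m%:R * (2 * n%:R * harm R n)); last by ring.
by rewrite ler_wpM2l ?mulr_ge0// sum_gcd_div_max.
Qed.

Lemma arcsum_period c k : Wa c (k + P%:Z) = Wa c k.
Proof.
rewrite /Wa /arcsum; apply: eq_bigr => x _.
by rewrite -[P%:Z]mulr1 dirichlet_period.
Qed.

Lemma sum_multiples_count g : (0 < g)%N -> (g %| P)%N ->
  \sum_(c < P) (P %| c * g)%N%:R = g%:R :> R.
Proof.
move=> g0 gP; have /dvdnP[p PE] := gP.
have p0 : (0 < p)%N by move: P0; rewrite PE muln_gt0 => /andP[].
rewrite PE -[in RHS](card_ord g) -sumr_const.
rewrite -(sum_multiples (fun=> 1 : R) p0 g0) [RHS]big_mkcond/=.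
by apply: eq_bigr => c _; case: ifP.
Qed.

Lemma sum_arcsum2 : \sum_(a < P) \sum_(c < P) Wa c (a%:Z - c%:Z) ^+ 2 <=
  P%:R * (6 * m%:R * (n%:R * harm R n)).
Proof.
rewrite exchange_big/=.
under eq_bigr => c _.
  rewrite (sum_period_shift P0 (F := fun k => Wa c k ^+ 2) (- c%:Z)); last first.
    by move=> j; rewrite arcsum_period.
  over.
rewrite exchange_big/=.
have WE c a : Wa c a ^+ 2 = \sum_(1 <= x < n.+1) \sum_(1 <= y < n.+1)
   (P %| c * gcdn x y)%N%:R * ((x%:R * y%:R)^-1 *
    (dirichlet (x * m) (1%:R * angle R P a) * dirichlet (y * m) (1%:R * angle R P a))).
  rewrite /Wa /arcsum big_mkcond expr2 big_distrlr/=.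
  apply: eq_bigr => x _; apply: eq_bigr => y _.
  rewrite muln_gcdr dvdn_gcd !mul1r invfM.
  by do 2!case: ifP => _; rewrite ?mul0r ?mulr0//= mul1r; ring.
under eq_bigr => a _ do under eq_bigr => c _ do rewrite WE.
under eq_bigr do rewrite exchange_big/=.
rewrite exchange_big/=.
apply: (@le_trans _ _ (\sum_(1 <= x < n.+1) \sum_(1 <= y < n.+1)
   P%:R * (3 * m%:R * ((gcdn x y)%:R / (maxn x y)%:R)))); last first.
  under eq_bigr do rewrite -mulr_sumr -mulr_sumr.
  rewrite -mulr_sumr -mulr_sumr ler_wpM2l//.
  rewrite (_ : 6 * _ * _ = 3 * m%:R * (2 * n%:R * harm R n)); last by ring.
  by rewrite ler_wpM2l ?mulr_ge0// sum_gcd_div_max.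
apply: ler_sum1 => x x0 xn.
under eq_bigr do rewrite exchange_big/=.
rewrite exchange_big/=; apply: ler_sum1 => y y0 yn.
under eq_bigr do rewrite -mulr_suml sum_multiples_count ?gcdn_gt0 ?x0 ?(dvdn_trans (dvdn_gcdl _ _)) ?nP//.
rewrite -mulr_sumr -mulr_sumr.
under eq_bigr do rewrite !dirichlet_cos_sum.
rewrite sum_cos_sum2//; try exact: sprog_odd.
set N := (\sum_i _)%N.
have hN : N%:R / (x%:R * y%:R) <= 3 * m%:R / (maxn x y)%:R :> R.
  have x0' : 0 < x%:R :> R by rewrite ltr0n.
  have y0' : 0 < y%:R :> R by rewrite ltr0n.
  have hx : (N <= 3 * m * x)%N.
    apply: (@leq_trans (\sum_(i < (x * m).*2.+1) 1)%N).
      by apply: leq_sum => i _; apply: sum_sprog_le1 => //; nia.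
    by rewrite sum1_card card_ord; nia.
  have hy : (N <= 3 * m * y)%N.
    rewrite /N exchange_big/=.
    apply: (@leq_trans (\sum_(i < (y * m).*2.+1) 1)%N).
      apply: leq_sum => i _; under eq_bigr do rewrite addrC.
      by apply: sum_sprog_le1 => //; nia.
    by rewrite sum1_card card_ord; nia.
  rewrite ler_pdivrMr ?mulr_gt0//.
  have [xy|xy] := leqP x y.
    by rewrite (mulrC x%:R) mulrA divfK ?gt_eqF// -!natrM ler_nat.
  by rewrite mulrA divfK ?gt_eqF// -!natrM ler_nat.
rewrite [leLHS](_ : _ = P%:R * ((gcdn x y)%:R * (N%:R / (x%:R * y%:R)))); last by ring.
by rewrite ler_wpM2l// [leRHS]mulrCA ler_wpM2l.
Qed.

Lemma sum_arcsum3 : \sum_(a < P) \sum_(c < P) Wa c (a%:Z - c%:Z) ^+ 3 =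
  P%:R * mainsum R n m.
Proof.
rewrite exchange_big/=.
under eq_bigr => c _.
  rewrite (sum_period_shift P0 (F := fun k => Wa c k ^+ 3) (- c%:Z)); last first.
    by move=> j; rewrite arcsum_period.
  over.
rewrite exchange_big/=.
have WE c a : Wa c a ^+ 3 = \sum_(1 <= x < n.+1) \sum_(1 <= y < n.+1) \sum_(1 <= z < n.+1)
   (P %| c * gcdn (gcdn x y) z)%N%:R * ((x%:R * y%:R * z%:R)^-1 *
    (dirichlet (x * m) (1%:R * angle R P a) * dirichlet (y * m) (1%:R * angle R P a)
      * dirichlet (z * m) (1%:R * angle R P a))).
  rewrite /Wa /arcsum big_mkcond exprS expr2 [X in _ * X]big_distrlr/= big_distrl/=.
  apply: eq_bigr => x _; rewrite big_distrr/=.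
  apply: eq_bigr => y _; rewrite big_distrr/=; apply: eq_bigr => z _.
  rewrite !muln_gcdr !dvdn_gcd !mul1r !invfM.
  by do 3!case: ifP => _; rewrite ?mul0r ?mulr0 ?mul0r//= mul1r; ring.
under eq_bigr => a _ do under eq_bigr => c _ do rewrite WE.
under eq_bigr do rewrite exchange_big/=.
rewrite exchange_big/= /mainsum mulr_sumr; apply: eq_big_nat => x /andP[x0 xn].
under eq_bigr do rewrite exchange_big/=.
rewrite exchange_big/= mulr_sumr; apply: eq_big_nat => y /andP[y0 yn].
under eq_bigr do rewrite exchange_big/=.
rewrite exchange_big/= mulr_sumr; apply: eq_big_nat => z /andP[z0 zn].
have g0 : (0 < gcdn (gcdn x y) z)%N by rewrite !gcdn_gt0 x0.
have gP : (gcdn (gcdn x y) z %| P)%N.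
  by rewrite (dvdn_trans (dvdn_gcdr _ _))// nP.
under eq_bigr do rewrite -mulr_suml sum_multiples_count//.
rewrite -mulr_sumr -mulr_sumr.
under eq_bigr do rewrite !dirichlet_cos_sum.
rewrite sum_cos_sum3//; try exact: sprog_odd.
rewrite (_ : (\sum_i _)%N = hexcount (x * m) (y * m) (z * m)); first by ring.
apply: eq_bigr => i _; apply: eq_bigr => j _; apply: eq_bigr => k _.
rewrite dvdz_small.
  congr nat_of_bool; rewrite /sprog !mulr1.
  by apply/eqP/eqP; lia.
have := sprog_le 1 i; have := sprog_le 1 j; have := sprog_le 1 k; rewrite !muln1.
have : (x * m + y * m + z * m < P)%N by nia.
move: (sprog _ _) (sprog _ _) (sprog _ _) => s t u.
move: (x * m)%N (y * m)%N (z * m)%N => a b c; lia.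
Qed.

(** Enumerates the nonzero integers of absolute value at most N. *)
Definition signed_val (N : nat) (p : 'I_N * bool) : int :=
  if p.2 then - (p.1.+1)%:Z else (p.1.+1)%:Z.

Definition prod_val (N M : nat) (p : ('I_N * bool) * ('I_M * bool)) : int :=
  signed_val p.1 * signed_val p.2.

(** The quantity to be estimated, indexed by the triples of pairs (x_l, y_l). *)
Definition zerocount (N M : nat) : nat :=
  (\sum_i \sum_j \sum_k ((@prod_val N M i + @prod_val N M j + @prod_val N M k)%R == 0%R))%N.

Lemma prod_val_odd N M : odd_family (@prod_val N M).
Proof.
exists (fun p => ((p.1.1, ~~ p.1.2), p.2)).
  by move=> [[i b] q] [[i' b'] q'] [-> /negb_inj-> ->].
move=> [[i b] q]; rewrite /prod_val /= -mulNr; congr (_ * _).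
by case: b; rewrite /signed_val/= ?opprK.
Qed.

(** The four choices of signs give equal cosines, and D_m = 1 + 2 (sum of the cosines of
    positive index); the subtracted n is the contribution of y = 0. *)
Lemma cos_sum_prod_val a : cos_sum R P (@prod_val n m) a = 2 * (Sa a - n%:R).
Proof.
have DE N t : dirichlet N t = 1 + 2 * \sum_(j < N) cos (j.+1%:R * t) :> R.
  rewrite /dirichlet.
  rewrite -(big_mkord xpredT (fun i => cos ((i%:R - N%:R) * t))).
  rewrite (big_cat_nat _ (n := N))//=; last by lia.
  rewrite big_nat_rev/= add0n -[X in index_iota X N.*2.+1](add0n N) big_addn (_ : N.*2.+1 - N = N.+1)%N; last by lia.
  rewrite [X in _ + X]big_ltn// add0n subrr mul0r cos0 big_add1/= !big_mkord.
  have -> : \sum_(i < N) cos (((N - i.+1)%N%:R - N%:R) * t) = \sum_(j < N) cos (j.+1%:R * t).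
    by apply: eq_bigr => i _; rewrite natrB// -cosN; congr cos; ring.
  have -> : \sum_(i < N) cos (((i.+1 + N)%N%:R - N%:R) * t) = \sum_(j < N) cos (j.+1%:R * t).
    by apply: eq_bigr => i _; rewrite natrD addrK.
  by ring.
rewrite /Sa /expsum -[n%:R]mulr1 -(sum_const1 n) -sumrB.
rewrite big_add1/= big_mkord mulr_sumr.
rewrite /cos_sum -(pair_bigA _ (fun p q => cos (angle R P (prod_val (p, q) * a))))/=.
rewrite -(pair_bigA _ (fun i b => \sum_q cos (angle R P (prod_val ((i, b), q) * a))))/=.
apply: eq_bigr => i _; rewrite DE [1 + _]addrC addrK.
have E b : \sum_q cos (angle R P (@prod_val n m ((i, b), q) * a)) =
   2 * \sum_(j < m) cos (j.+1%:R * (i.+1%:R * angle R P a)).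
  rewrite -(pair_bigA _ (fun j b' => cos (angle R P (@prod_val n m ((i, b), (j, b')) * a))))/=.
  rewrite mulr_sumr; apply: eq_bigr => j _.
  have E' : j.+1%:R * (i.+1%:R * angle R P a) = angle R P ((i.+1 * j.+1)%N%:Z * a).
    rewrite -[j.+1%:R]/((j.+1%:Z)%:~R) -[i.+1%:R]/((i.+1%:Z)%:~R) !angleM.
    by congr angle; rewrite PoszM; ring.
  have C z : z = (i.+1 * j.+1)%N%:Z \/ z = - (i.+1 * j.+1)%N%:Z ->
      cos (angle R P (z * a)) = cos (angle R P ((i.+1 * j.+1)%N%:Z * a)).
    by case=> ->; rewrite // mulNr angleN cosN.
  rewrite big_bool/= E' !C; first by ring.
    by rewrite /prod_val /signed_val/=; case: b; [right|left]; lia.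
  by rewrite /prod_val /signed_val/=; case: b; [left|right]; lia.
by rewrite big_bool/= !E; ring.
Qed.

Lemma sum_cos_sum_cube : \sum_(a < P) cos_sum R P (@prod_val n m) a%:Z ^+ 3 = P%:R * (zerocount n m)%:R.
Proof.
under eq_bigr do rewrite !exprS expr0 mulr1 mulrA.
rewrite sum_cos_sum3//; try exact: prod_val_odd.
congr (_ * _%:R); apply: eq_bigr => i _; apply: eq_bigr => j _; apply: eq_bigr => k _.
rewrite dvdz_small//.
have h (p : ('I_n * bool) * ('I_m * bool)) : `|prod_val p| <= (n * m)%N%:Z.
  case: p => [[u b] [v b']]; rewrite /prod_val normrM PoszM; apply: ler_pM => //;
  by rewrite /signed_val/=; case: ifP; rewrite ?normrN; have := ltn_ord u; have := ltn_ord v; lia.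
have := h i; have := h j; have := h k; move: nmP; rewrite -mulnA.
move: (prod_val _) (prod_val _) (prod_val _) (n * m)%N => s t u v; lia.
Qed.

(** Both replacements, of T - n by T (inequality h1) and of the cube of T by the diagonal cubes
    (inequality h2), cost at most O(n log n) times a mean square, hence O(n^2 m log^2 n). *)
Lemma zerocount_mainsum : (n <= m)%N ->
  `|(zerocount n m)%:R - 8 * mainsum R n m| <= 100 * 500 * (n%:R ^+ 2 * m%:R * harm R n ^+ 2).
Proof.
move=> nm.
have P0' : 0 < P%:R :> R by rewrite ltr0n P0.
have n0' : 0 < n%:R :> R by rewrite ltr0n.
have H1 := harm_ge1 R n0.
set H := harm R n in H1 *.
have hS := sum_expsum2; have hW := sum_arcsum2; rewrite -/H in hS hW.
set s2 := \sum_(a < P) _ in hS; set w2 := \sum_(a < P) _ in hW.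
rewrite -(ler_pM2l P0') -[X in X * `|_|](ger0_norm (ltW P0')) -normrM mulrBr mulrCA -sum_arcsum3 -sum_cos_sum_cube.
have h1 : `|\sum_(a < P) (cos_sum R P (@prod_val n m) a%:Z ^+ 3 - 8 * Sa a%:Z ^+ 3)| <=
   36 * n%:R * s2 + 20 * n%:R ^+ 3 * P%:R.
  rewrite (le_trans (ler_norm_sum _ _ _))//.
  have -> : 20 * n%:R ^+ 3 * P%:R = \sum_(a < P) 20 * n%:R ^+ 3 :> R.
    by rewrite sumr_const card_ord mulr_natr.
  rewrite /s2 mulr_sumr -big_split/=.
  apply: ler_sum => a _; rewrite cos_sum_prod_val.
  move: (Sa _) => s.
  rewrite (_ : _ - _ = - (8 * n%:R) * (3 * s ^+ 2 - 3 * n%:R * s + n%:R ^+ 2)); last by ring.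
  have n8 : 0 <= 8 * n%:R :> R by rewrite mulr_ge0.
  rewrite mulNr normrN normrM (ger0_norm n8).
  rewrite [leRHS](_ : _ = 8 * n%:R * (9 / 2 * s ^+ 2 + 5 / 2 * n%:R ^+ 2)); last by field.
  rewrite ler_wpM2l ?mulr_ge0// ger0_norm; first by have := sqr_ge0 (s + n%:R); nra.
  by have := sqr_ge0 (s - n%:R / 2); have := sqr_ge0 n%:R; nra.
have h2 : `|\sum_(a < P) (Sa a%:Z ^+ 3 - \sum_(c < P) Wa c (a%:Z - c%:Z) ^+ 3)| <=
   560 * (n%:R * H) * (s2 + w2).
  rewrite (le_trans (ler_norm_sum _ _ _))// -big_split/= mulr_sumr.
  by apply: ler_sum => a _; apply: cube_diagonal_bound.
rewrite (_ : _ - _ = \sum_(a < P) (cos_sum R P (@prod_val n m) a%:Z ^+ 3 - 8 * Sa a%:Z ^+ 3)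
  + 8 * \sum_(a < P) (Sa a%:Z ^+ 3 - \sum_(c < P) Wa c (a%:Z - c%:Z) ^+ 3)); last first.
  by rewrite !sumrB -!mulr_sumr; ring.
rewrite (le_trans (ler_normD _ _))// (le_trans (lerD h1 (lexx _)))// normrM ger0_norm//.
rewrite (le_trans (lerD (lexx _) (ler_wpM2l _ h2)))//.
have nm' : n%:R <= m%:R * H :> R.
  apply: le_trans (_ : m%:R <= _); first by rewrite ler_nat.
  by rewrite ler_peMr.
have nn : n%:R ^+ 2 <= n%:R * m%:R * H :> R by rewrite expr2 -mulrA ler_pM2l.
set A := n%:R * m%:R * H in nn.
have A0 : 0 <= A by rewrite !mulr_ge0//; lra.
have s2b : s2 <= P%:R * (5 * A).
  apply: le_trans hS _; rewrite ler_pM2l// (_ : 4 * _ * _ = 4 * A); last by rewrite /A; ring.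
  lra.
have w2b : w2 <= P%:R * (6 * A).
  by apply: le_trans hW _; rewrite ler_pM2l// /A; lra.
have nH : n%:R <= n%:R * H :> R by rewrite ler_peMr// ltW.
rewrite (_ : P%:R * (100 * 500 * _) = 100 * 500 * (n%:R * H) * (P%:R * A)); last by rewrite /A; ring.
have PA : 0 <= P%:R * A by rewrite mulr_ge0// ltW.
have c1 : n%:R * s2 <= n%:R * H * (5 * (P%:R * A)).
  apply: le_trans (ler_wpM2l (ltW n0') s2b) _.
  by rewrite [P%:R * _]mulrCA ler_wpM2r// mulr_ge0.
have c2 : n%:R ^+ 3 * P%:R <= n%:R * H * (P%:R * A).
  rewrite exprS -mulrA (mulrC (n%:R ^+ 2)).
  apply: ler_pM (ltW n0') _ nH _; first by rewrite mulr_ge0// exprn_ge0.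
  by rewrite ler_pM2l.
have c3 : n%:R * H * (s2 + w2) <= n%:R * H * (11 * (P%:R * A)).
  by rewrite ler_wpM2l ?mulr_ge0//; lra.
have X0 : 0 <= n%:R * H * (P%:R * A) by rewrite mulr_ge0 ?(le_trans (ltW n0') nH).
lra.
Qed.

End Averages.

(** * From pairs of vectors to signed indices *)

Section Counting.

Lemma signed_val_inj N : injective (@signed_val N).
Proof.
move=> [i b] [j c]; rewrite /signed_val/=; case: b; case: c => h;
  by [congr (_, _); apply/val_inj => /=; lia | lia].
Qed.

Lemma signed_val_neq0 N (p : 'I_N * bool) : signed_val p != 0.
Proof. by rewrite /signed_val; case: ifP => _; lia. Qed.

Lemma signed_val_le N (p : 'I_N * bool) : `|signed_val p| <= N%:Z.
Proof. by rewrite /signed_val; have := ltn_ord p.1; case: ifP => _; lia. Qed.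

Lemma signed_val_surj N (z : int) : z != 0 -> `|z| <= N%:Z -> exists p : 'I_N * bool, signed_val p = z.
Proof.
move=> z0 zN; have h : (`|z|%N.-1 < N)%N by lia.
by exists (Ordinal h, z < 0); rewrite /signed_val/=; case: ltP; lia.
Qed.

Definition pick3 (T : Type) (t : T * T * T) (l : 'I_3) : T :=
  if l == 0 then t.1.1 else if l == 1 then t.1.2 else t.2.

Definition rows_of n m (t : let I := (('I_n * bool) * ('I_m * bool))%type in (I * I * I)%type) :
    'rV[int]_3 * 'rV[int]_3 :=
  (\row_l signed_val (pick3 t l).1, \row_l signed_val (pick3 t l).2).

Lemma rows_of_inj n m : injective (@rows_of n m).
Proof.
move=> [[a b] c] [[a' b'] c'] [/rowP h1 /rowP h2].
have e l : pick3 (a, b, c) l = pick3 (a', b', c') l.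
  move: (h1 l) (h2 l); rewrite !mxE => /signed_val_inj u /signed_val_inj v.
  by rewrite [LHS]surjective_pairing u v -surjective_pairing.
by have := e 0; have := e 1; have := e 2; rewrite /pick3/= => -> -> ->.
Qed.

Lemma sum_pick3 (V : nmodType) (T : Type) (t : T * T * T) (F : T -> V) :
  \sum_(l < 3) F (pick3 t l) = F t.1.1 + F t.1.2 + F t.2.
Proof. by rewrite !big_ord_recl big_ord0 /pick3/= addr0 addrA. Qed.

Lemma M_zerocount (R : realType) (X Y : R) : 0 <= X -> 0 <= Y ->
  M X Y = zerocount (Num.truncn X) (Num.truncn Y).
Proof.
move=> X0 Y0; set n := Num.truncn X; set m := Num.truncn Y.
pose I : finType := (('I_n * bool) * ('I_m * bool))%type.
pose z (t : I * I * I) := prod_val t.1.1 + prod_val t.1.2 + prod_val t.2.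
have supn (N : nat) (Z : R) (x : 'rV[int]_3) : 0 <= Z -> N = Num.truncn Z ->
    reflect (forall l, `|x 0 l| <= N%:Z) ((supnorm x)%:~R <= Z).
  move=> Z0 NE; apply: (iffP idP) => h.
    move=> l; rewrite -abszE lez_nat NE truncn_ge_nat//.
    apply: le_trans h; rewrite -[_%:R]/((absz (x 0 l))%:Z%:~R) ler_int abszE.
    exact: ler_supnorm.
  apply: (@le_trans _ _ N%:R); last by rewrite NE truncn_le.
  by rewrite -[N%:R]/((N%:Z)%:~R) ler_int supnormE !ge_max !h.
rewrite /M; have -> : Mset X Y = [set` [fset rows_of t | t in [pred t : I * I * I | z t == 0]]%fset].
  apply/seteqP; split => [[x y]|_ /= /imfsetP[t /= tz ->]].
    case=> x0 y0 xy /(supn n)-/(_ X0 erefl) xn /(supn m)-/(_ Y0 erefl) ym.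
    have ex l : exists p : I, signed_val p.1 = x 0 l /\ signed_val p.2 = y 0 l.
      have [p1 e1] := signed_val_surj (x0 l) (xn l); have [p2 e2] := signed_val_surj (y0 l) (ym l).
      by exists (p1, p2).
    have [a [a1 a2]] := ex 0; have [b [b1 b2]] := ex 1; have [c [c1 c2]] := ex 2.
    have e l : signed_val (pick3 (a, b, c) l).1 = x 0 l /\ signed_val (pick3 (a, b, c) l).2 = y 0 l.
      case: l => [[|[|[|l]]] hl] //; rewrite /pick3/=.
      + by rewrite a1 a2; split; congr (_ 0 _); apply/val_inj.
      + by rewrite b1 b2; split; congr (_ 0 _); apply/val_inj.
      + by rewrite c1 c2; split; congr (_ 0 _); apply/val_inj.
    apply/imfsetP; exists (a, b, c) => /=.
      suff : z (a, b, c) == 0 by [].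
      have -> : z (a, b, c) = \sum_(l < 3) @prod_val n m (pick3 (a, b, c) l) by rewrite sum_pick3.
      apply/eqP; rewrite -[RHS]xy; apply: eq_bigr => l _; rewrite /prod_val.
      by have [-> ->] := e l.
    by congr (_, _); apply/rowP => l; rewrite mxE; have [] := e l.
  split.
  - by move=> l; rewrite mxE signed_val_neq0.
  - by move=> l; rewrite mxE signed_val_neq0.
  - transitivity (\sum_(l < 3) prod_val (pick3 t l)).
      by apply: eq_bigr => l _; rewrite !mxE.
    by rewrite sum_pick3; apply/eqP; exact: tz.
  - by apply/(supn n) => // l; rewrite mxE signed_val_le.
  - by apply/(supn m) => // l; rewrite mxE signed_val_le.
rewrite set_fsetK card_imfset/=; last exact: rows_of_inj.
rewrite -cardE /zerocount -sum1_card pair_big/= pair_big/= big_mkcond/=.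
apply: eq_bigr => -[[a b] c] _ /=.
have -> : ((a, b, c) \in [pred t : I * I * I | z t == 0]) = (prod_val a + prod_val b + prod_val c == 0) by [].
by case: (_ == 0).
Qed.

End Counting.

(** * Values of zeta *)

Section Zeta.
Variable R : realType.

Lemma zetasum_homo s n k : (n <= k)%N -> zetasum R s n <= zetasum R s k.
Proof.
move=> /subnKC <-; elim: (k - n)%N => [|j IH]; first by rewrite addn0.
by rewrite addnS zetasumS (le_trans IH)// lerDl invr_ge0 exprn_ge0.
Qed.

(** t n - t (n + 1) telescopes against the terms of the series. *)
Lemma zetasum_tail s (t : nat -> R) : (forall n, 0 <= t n) ->
  (forall n, (0 < n)%N -> (n.+1%:R ^+ s)^-1 <= t n - t n.+1) ->
  forall k n, (0 < k)%N -> zetasum R s n <= zetasum R s k + t k.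
Proof.
move=> t0 ht k n k0.
have [nk|/ltnW kn] := leqP n k.
  by rewrite (le_trans (zetasum_homo s nk))// lerDl.
suff : zetasum R s n + t n <= zetasum R s k + t k by apply: le_trans; rewrite lerDl.
move: kn => /subnKC <-; elim: (n - k)%N => [|j IH]; first by rewrite addn0.
rewrite addnS zetasumS; have := ht (k + j)%N; rewrite addn_gt0 k0 => /(_ isT); lra.
Qed.

Lemma zeta_zetasum s (t : nat -> R) : (forall n, 0 <= t n) ->
  (forall n, (0 < n)%N -> (n.+1%:R ^+ s)^-1 <= t n - t n.+1) ->
  forall k, (0 < k)%N -> 0 <= zeta s%:R - zetasum R s k <= t k.
Proof.
move=> t0 ht.
have E : series (riemannR (s%:R : R)) = zetasum R s.
  apply/funext => n; rewrite /series/= /zetasum big_add1/=.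
  by apply: eq_bigr => k _; rewrite /riemannR powR_mulrn.
have nd : nondecreasing_seq (zetasum R s) by move=> a b ab; apply: zetasum_homo.
have cv : cvgn (zetasum R s).
  apply: nondecreasing_is_cvgn => //; exists (zetasum R s 1 + t 1%N) => _ [n _ <-].
  exact: zetasum_tail.
move=> k k0; rewrite /zeta E subr_ge0 nondecreasing_cvgn_le//= lerBlDl.
by apply: limr_le => //; apply: nearW => n; apply: zetasum_tail.
Qed.

Lemma zeta2_zetasum k : (0 < k)%N -> 0 <= zeta 2 - zetasum R 2 k <= k%:R^-1.
Proof.
apply: (@zeta_zetasum 2 (fun n => n%:R^-1)) => [n|n n0]; first by rewrite invr_ge0.
have n1 : 0 < n%:R :> R by rewrite ltr0n.
rewrite -(natr1 n) -subr_ge0.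
rewrite (_ : _ - _ = (n%:R * (n%:R + 1) ^+ 2)^-1); last by field; posne.
by rewrite invr_ge0 mulr_ge0// ?ltW// exprn_ge0// addr_ge0// ltW.
Qed.

Lemma zeta3_zetasum k : (0 < k)%N -> 0 <= zeta 3 - zetasum R 3 k <= (k%:R ^+ 2)^-1.
Proof.
apply: (@zeta_zetasum 3 (fun n => (n%:R ^+ 2)^-1)) => [n|n n0].
  by rewrite invr_ge0 exprn_ge0.
have n1 : 0 < n%:R :> R by rewrite ltr0n.
rewrite -(natr1 n) -subr_ge0.
rewrite (_ : _ - _ = (n%:R ^+ 2 + 3 * n%:R + 1) * (n%:R ^+ 2 * (n%:R + 1) ^+ 3)^-1); last by field; posne.
by rewrite mulr_ge0 ?invr_ge0 ?mulr_ge0 ?exprn_ge0 ?addr_ge0// ltW.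
Qed.

Definition cosec2 (t : R) : R := (sin t ^+ 2)^-1.

(** Halving: 1/sin^2 u + 1/cos^2 u = 4/sin^2(2u).  Pairing k with 2M - k exchanges sine and
    cosine, so that G(n+1) = 4 G(n) + 2, the 2 being the middle term k = M = 2^n. *)
Lemma sum_cosec2 n :
  \sum_(1 <= k < 2 ^ n) cosec2 (pi * k%:R / (2 ^ n.+1)%:R) = 2 / 3 * (4 ^+ n - 1).
Proof.
elim: n => [|n IH]; first by rewrite expn0 big_geq// expr0 subrr mulr0.
set M := (2 ^ n)%N in IH *.
have M0 : (0 < M)%N by rewrite expn_gt0.
have M0' : 0 < M%:R :> R by rewrite ltr0n.
have p0 := pi_gt0 R.
have E1 : (2 ^ n.+1 = M.*2)%N by rewrite expnS mul2n.
have E2 : (2 ^ n.+2 = M.*2.*2)%N by rewrite expnS E1 mul2n.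
rewrite E1 in IH; rewrite E1 E2.
have R2 : M.*2.*2%:R = 4 * M%:R :> R by rewrite -!muln2 !natrM; ring.
have R1 : M.*2%:R = 2 * M%:R :> R by rewrite -muln2 natrM mulrC.
rewrite R2; rewrite R1 in IH.
rewrite (big_cat_nat _ (n := M))//=; last by lia.
rewrite [X in _ + X]big_ltn; last by lia.
(* The middle index k = M is the angle pi/4. *)
have mid : cosec2 (pi * M%:R / (4 * M%:R)) = 2.
  have -> : pi * M%:R / (4 * M%:R) = pi / 4 :> R by field; posne.
  rewrite /cosec2.
  have := cos_mulr2n (pi / 4 : R).
  rewrite (_ : pi / 4 *+ 2 = pi / 2 :> R); last by rewrite mulr2n; lra.
  rewrite cos_pihalf cos2sin2 mulr2n => h.
  have -> : sin (pi / 4 : R) ^+ 2 = 2^-1 by lra.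
  by rewrite invrK.
rewrite mid.
have -> : \sum_(M.+1 <= i < M.*2) cosec2 (pi * i%:R / (4 * M%:R)) =
   \sum_(1 <= k < M) (cos (pi * k%:R / (4 * M%:R)) ^+ 2)^-1.
  rewrite big_nat_rev/= -{1}(add1n M) big_addn (_ : M.*2 - M = M)%N; last by lia.
  apply: eq_big_nat => k /andP[k0 kM]; rewrite /cosec2.
  have -> : (M.+1 + M.*2 - (k + M).+1 = M.*2 - k)%N by lia.
  rewrite natrB; last by lia.
  rewrite R1 (_ : pi * _ / _ = pi / 2 - pi * k%:R / (4 * M%:R)); last by field; posne.
  rewrite -cosBpihalf (_ : _ - _ - _ = - (pi * k%:R / (4 * M%:R))) ?cosN//; ring.
have -> : \sum_(1 <= i < M) cosec2 (pi * i%:R / (4 * M%:R)) +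
   (2 + \sum_(1 <= k < M) (cos (pi * k%:R / (4 * M%:R)) ^+ 2)^-1) =
   2 + 4 * \sum_(1 <= k < M) cosec2 (pi * k%:R / (2 * M%:R)).
  rewrite addrCA; congr (_ + _).
  rewrite -big_split/= mulr_sumr; apply: eq_big_nat => k /andP[k0 kM].
  set t := pi * _ / (4 * _).
  have -> : pi * k%:R / (2 * M%:R) = t *+ 2 by rewrite mulr2n /t; field; posne.
  have k0' : 0 < k%:R :> R by rewrite ltr0n.
  have t0 : 0 < t by rewrite divr_gt0 ?mulr_gt0.
  have t1 : t < pi / 2.
    rewrite /t ltr_pdivrMr ?mulr_gt0//.
    rewrite (_ : pi / 2 * _ = pi * (2 * M%:R)); last by field.
    rewrite ltr_pM2l//; have : k%:R < M%:R :> R by rewrite ltr_nat.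
    lra.
  have s0 : 0 < sin t by apply: sin_gt0_pihalf; rewrite t0.
  have c0 : 0 < cos t by apply: cos_gt0_pihalf; rewrite t1 andbT; lra.
  rewrite /cosec2 sin_mulr2n -mulr_natl.
  have h := cos2Dsin2 t.
  rewrite (_ : (sin t ^+ 2)^-1 + _ = (cos t ^+ 2 + sin t ^+ 2) / (sin t ^+ 2 * cos t ^+ 2)); last first.
    by field; posne.
  by rewrite h; field; posne.
by rewrite IH exprS; field.
Qed.

(** Between 0 and pi/2, 1/t^2 <= 1/sin^2 t <= 1/t^2 + 1; the preceding evaluation then pins
    the partial sums of zeta(2) to pi^2/6 with an error O(1/M), M = 2^(n+1). *)
Lemma basel : zeta 2 = pi ^+ 2 / 6 :> R.
Proof.
have p0 := pi_gt0 R; have p4 : pi < 4 :> R by have := pihalf_lt2 R; lra.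
have H n : `|zeta 2 - pi ^+ 2 / 6| <= 6 / n.+1%:R :> R.
  pose M := (2 ^ n.+1)%N.
  have Mn : (n.+2 <= M)%N by rewrite ltn_expl.
  have M1 : 1 + n.+1%:R <= M%:R :> R by rewrite nat1r ler_nat.
  have n0 := ler0n R n; have n1 : 1 <= n.+1%:R :> R by rewrite ler1n.
  have Mp : (M.-1.+1 = M)%N by rewrite prednK// (leq_trans _ Mn).
  have Mr : M.-1%:R + 1 = M%:R :> R by rewrite natr1 Mp.
  have ME : (2 ^ n.+2)%:R = 2 * M%:R :> R by rewrite expnS natrM.
  have := sum_cosec2 n.+1; rewrite -/M ME.
  set S := \sum_(_ <= _ < _) _.
  have -> : 4 ^+ n.+1 = M%:R ^+ 2 :> R by rewrite natrX -exprM mulnC exprM; congr (_ ^+ _); ring.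
  move=> SE.
  have ZE : \sum_(1 <= k < M) ((pi * k%:R / (2 * M%:R)) ^+ 2)^-1 =
     4 * M%:R ^+ 2 / pi ^+ 2 * zetasum R 2 M.-1.
    rewrite /zetasum Mp mulr_sumr; apply: eq_big_nat => k /andP[k0 _].
    have k0' : 0 < k%:R :> R by rewrite ltr0n.
    by field; posne.
  have bnd k : (0 < k)%N -> (k < M)%N -> ((pi * k%:R / (2 * M%:R)) ^+ 2)^-1 <= cosec2 (pi * k%:R / (2 * M%:R))
       <= ((pi * k%:R / (2 * M%:R)) ^+ 2)^-1 + 1.
    move=> k0 kM; set t : R := pi * k%:R / (2 * M%:R).
    have k0' : 0 < k%:R :> R by rewrite ltr0n.
    have t0 : 0 < t by rewrite divr_gt0 ?mulr_gt0//; lra.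
    have t1 : t < pi / 2.
      rewrite /t ltr_pdivrMr ?mulr_gt0//; last by lra.
      rewrite (_ : pi / 2 * _ = pi * M%:R); last by field.
      by rewrite ltr_pM2l// ltr_nat.
    have s0 : 0 < sin t by apply: sin_gt0_pihalf; rewrite t0.
    have s1 := sin_le (ltW t0).
    have c0 : 0 < cos t by apply: cos_gt0_pihalf; rewrite t1 andbT; lra.
    have s2 : t * cos t <= sin t by apply: cos_le_sin; apply/andP; split; lra.
    apply/andP; split.
      by rewrite lef_pV2 ?posrE ?exprn_gt0// ler_sqr ?nnegrE//; exact: ltW.
    rewrite /cosec2 -[leLHS]mul1r ler_pdivrMr ?exprn_gt0//.
    rewrite (_ : _ * sin t ^+ 2 = (sin t / t) ^+ 2 + sin t ^+ 2); last by field; posne.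
    have : cos t ^+ 2 <= (sin t / t) ^+ 2.
      have ct : cos t <= sin t / t by rewrite ler_pdivlMr// mulrC.
      by rewrite ler_sqr ?nnegrE// ltW// (lt_le_trans c0).
    by have := cos2Dsin2 t; lra.
  have lo : 4 * M%:R ^+ 2 / pi ^+ 2 * zetasum R 2 M.-1 <= S.
    by rewrite -ZE; apply: ler_sum_nat => k /andP[k0 kM]; have /andP[] := bnd k k0 kM.
  have hi : S <= 4 * M%:R ^+ 2 / pi ^+ 2 * zetasum R 2 M.-1 + (M%:R - 1).
    rewrite -ZE; apply: (@le_trans _ _ (\sum_(1 <= k < M) ((pi * k%:R / (2 * M%:R)) ^+ 2)^-1 + M.-1%:R)).
      rewrite -[M.-1%:R]mulr1 -(sum_const1 M.-1) Mp -big_split/=.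
      by apply: ler_sum_nat => k /andP[k0 kM]; have /andP[] := bnd k k0 kM.
    by rewrite lerD2l; lra.
  set z := zetasum R 2 M.-1 in lo hi.
  have /andP[z0 z1] : 0 <= zeta 2 - z <= M.-1%:R^-1 by apply: zeta2_zetasum; rewrite -ltnS Mp (leq_trans _ Mn).
  have M0 : 0 < M%:R :> R by lra.
  have pp : 0 < pi ^+ 2 :> R by rewrite exprn_gt0.
  have MM : 0 < M%:R ^+ 2 :> R by rewrite exprn_gt0.
  have p16 : pi ^+ 2 <= 16 :> R.
    by rewrite (_ : 16 = 4 ^+ 2) ?ler_sqr ?nnegrE//; [lra|lra|ring].
  (* lo, hi and SE squeeze z between pi^2/6 - 4/M and pi^2/6. *)
  have a1 : z <= pi ^+ 2 / 6.
    have : 4 * M%:R ^+ 2 / pi ^+ 2 * z <= 4 * M%:R ^+ 2 / pi ^+ 2 * (pi ^+ 2 / 6).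
      rewrite (le_trans lo)// SE (_ : 4 * _ / _ * _ = 2 / 3 * M%:R ^+ 2); last by field; posne.
      by lra.
    by rewrite ler_pM2l// divr_gt0// mulr_gt0.
  have a2 : pi ^+ 2 / 6 <= z + 4 / M%:R.
    have : 4 * M%:R ^+ 2 / pi ^+ 2 * (pi ^+ 2 / 6) <= 4 * M%:R ^+ 2 / pi ^+ 2 * (z + pi ^+ 2 / (4 * M%:R)).
      rewrite (_ : 4 * _ / _ * (_ / 6) = 2 / 3 * M%:R ^+ 2); last by field; posne.
      rewrite mulrDr (_ : 4 * _ / _ * (_ / (4 * _)) = M%:R); last by field; posne.
      by move: hi; rewrite SE; lra.
    rewrite ler_pM2l ?divr_gt0 ?mulr_gt0// => h; apply: (le_trans h).
    rewrite lerD2l ler_pdivrMr ?mulr_gt0// (_ : 4 / _ * _ = 16) ?(le_trans p16)//.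
    by field; posne.
  have b1 : M.-1%:R^-1 <= n.+1%:R^-1 :> R.
    have nM : (n < M.-1)%N by rewrite -ltnS Mp.
    by rewrite lef_pV2 ?posrE ?ltr0n ?ler_nat// (leq_ltn_trans _ nM).
  have b2 : M%:R^-1 <= n.+1%:R^-1 :> R.
    by rewrite lef_pV2 ?posrE// ?ltr0n// ler_nat; exact: ltnW.
  have e0 : 0 <= n.+1%:R^-1 :> R by rewrite invr_ge0.
  move: e0 b1 b2 a1 a2 z0 z1; rewrite ler_norml.
  move: (n.+1%:R^-1) (M%:R^-1) (M.-1%:R^-1) => e u v e0 b1 b2 a1 a2 z0 z1.
  by apply/andP; split; lra.
apply/eqP; rewrite -subr_eq0 -normr_le0 leNgt; apply/negP => d0.
set d := `|_| in d0 H.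
have := H (Num.truncn (6 / d)).
rewrite ler_pdivlMr ?ltr0n// mulrC -ler_pdivlMr// => h.
have d6 : 0 <= 6 / d by rewrite divr_ge0// ltW.
by have /andP[_] := truncn_itv d6; rewrite ltNge h.
Qed.

Lemma harm_le_ln n : (0 < n)%N -> harm R n <= 1 + ln n%:R.
Proof.
elim: n => [//|[|n] IH _]; first by rewrite /harm big_nat1 invr1 ln1 addr0.
rewrite harmS (le_trans (lerD (IH isT) (lexx _)))// -addrA lerD2l.
have n0 := ler0n R n.
have p1 : 0 < n.+1%:R :> R by rewrite ltr0n.
have p2 : 0 < n.+2%:R :> R by rewrite ltr0n.
have e : 1 + - n.+2%:R^-1 = n.+1%:R / n.+2%:R :> R by rewrite -(natr1 n.+1); field; posne.
have := @le_ln1Dx R (- n.+2%:R^-1).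
rewrite e ln_div ?posrE// => h.
have {}h : ln n.+1%:R - ln n.+2%:R <= - (n.+2%:R : R)^-1.
  by apply: h; rewrite ltrN2 invf_lt1// ltr1n.
by move: h; move: (ln _) (ln _) (_^-1) => x y u; lra.
Qed.

End Zeta.

(** * The asymptotic formula *)

(** The modulus P = n! (3 n m + 1) is divisible by every x <= n and exceeds 3 n m, the largest
    value of the form. *)
Lemma zerocount_asymp (R : realType) (n m : nat) : (0 < n)%N -> (n <= m)%N ->
  `|(zerocount n m)%:R - 2 * (33 - pi ^+ 2) * (zeta 2 / zeta 3) * (n%:R * m%:R) ^+ 2|
    <= 100 * 600 * (n%:R * m%:R ^+ 2 * harm R n ^+ 2) :> R.
Proof.
move=> n0 nm; have m0 : (0 < m)%N := leq_trans n0 nm.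
pose P := (n`! * (3 * n * m).+1)%N.
have nP x : (0 < x)%N -> (x <= n)%N -> (x %| P)%N.
  by move=> x0 xn; rewrite /P dvdn_mulr// dvdn_fact// x0.
have nmP : (3 * n * m < P)%N by rewrite /P leq_pmull// fact_gt0.
have hc := zerocount_mainsum R n0 m0 nP nmP nm.
have hz k : (0 < k)%N -> `|zetasum R 2 k - zeta 2| <= k%:R^-1.
  by move=> k0; have /andP[l u] := zeta2_zetasum R k0; rewrite distrC ger0_norm.
have hw : `|\sum_(1 <= d < n.+1) (totient d)%:R / d%:R ^+ 3 - zeta 2 / zeta 3| <= 5 / n%:R :> R.
  by apply: totient_zeta => //; apply: zeta3_zetasum.
have hm := mainsum_asymp n0 m0 hz hw.
have cE : 2 * (33 - pi ^+ 2) = 8 * (33 / 4 - 3 / 2 * zeta 2) :> R by rewrite basel; field.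
rewrite cE; set w := zeta 2 / zeta 3 in hm *; set c := 33 / 4 - _ in hm *.
set H := harm R n in hc hm *.
have H0 : 0 <= H ^+ 2 by rewrite exprn_ge0// harm_ge0.
have E : n%:R ^+ 2 * m%:R * H ^+ 2 <= n%:R * m%:R ^+ 2 * H ^+ 2.
  rewrite ler_wpM2r// !expr2 mulrAC -mulrA ler_wpM2l//.
  by rewrite ler_wpM2l// ler_nat.
have X0 : 0 <= n%:R * m%:R ^+ 2 * H ^+ 2 by rewrite mulr_ge0// mulr_ge0// exprn_ge0.
move: hc hm E X0; set A := _ * _ * H ^+ 2; set B := _ * _ * H ^+ 2.
rewrite -[8 * c * w]mulrA -[8 * (c * w) * _]mulrA.
rewrite !ler_norml; lra.
Qed.

Theorem mainTheorem4 (R : realType) :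
  exists C : R, forall X Y : R, 3 / 2 <= X -> X <= Y ->
    `| (M X Y)%:R - 2 * (33 - pi ^+ 2) * (zeta 2 / zeta 3) * (X * Y) ^+ 2 |
      <= C * (X * Y ^+ 2 * ln X * ln Y).
Proof.
pose c0 : R := 2 * (33 - pi ^+ 2) * (zeta 2 / zeta 3).
exists (1000 * 1000 + 36 * `|c0|) => X Y X1 XY.
have X0 : 0 <= X by lra.
have Y0 : 0 <= Y by lra.
rewrite M_zerocount// -/c0; set n := Num.truncn X; set m := Num.truncn Y.
have n0 : (0 < n)%N by rewrite truncn_ge_nat//; lra.
have nm : (n <= m)%N.
  by rewrite truncn_ge_nat// (le_trans _ XY)// truncn_le.
have /andP[nX Xn] := truncn_itv X0; have /andP[mY Ym] := truncn_itv Y0.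
rewrite -/n -natr1 in nX Xn; rewrite -/m -natr1 in mY Ym.
have n1 : 1 <= n%:R :> R by rewrite ler1n.
have m1 : 1 <= m%:R :> R by rewrite ler1n (leq_trans n0).
have h := @zerocount_asymp R n m n0 nm; rewrite -/c0 in h.
(* ln X is bounded below since X >= 3/2, which absorbs the constants in H_n <= 1 + ln n. *)
have lX : 1 / 3 <= ln X.
  have l3 : ln (2 / 3 : R) <= - (1 / 3).
    by rewrite (_ : 2 / 3 = 1 + - (1 / 3)); [apply: le_ln1Dx; lra|lra].
  have : ln (3 / 2 : R) <= ln X by rewrite ler_ln// posrE; lra.
  rewrite -[3 / 2]invrK lnV ?posrE ?invr_gt0; last by lra.
  by rewrite invf_div; lra.
have lXY : ln X <= ln Y by rewrite ler_ln// posrE; lra.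
have H4 : harm R n <= 4 * ln X.
  have : ln n%:R <= ln X by rewrite ler_ln// posrE; lra.
  by have := harm_le_ln R n0; lra.
have H0 := harm_ge0 R n.
set L := ln X * ln Y.
have L9 : 1 <= 9 * L by rewrite /L; nra.
have HL : harm R n ^+ 2 <= 16 * L.
  apply: (@le_trans _ _ (4 * ln X * (4 * ln Y))); last by rewrite /L; lra.
  by rewrite expr2; apply: ler_pM => //; lra.
have Y2 : 0 <= X * Y ^+ 2 by rewrite mulr_ge0// exprn_ge0.
have nmXY : n%:R * m%:R ^+ 2 <= X * Y ^+ 2.
  by apply: ler_pM => //; rewrite ?exprn_ge0// ler_sqr ?nnegrE.
have h1 : n%:R * m%:R ^+ 2 * harm R n ^+ 2 <= X * Y ^+ 2 * (16 * L).
  by apply: ler_pM => //; rewrite ?mulr_ge0 ?exprn_ge0.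
(* the cost of replacing X and Y by their integer parts *)
have h2 : `|(n%:R * m%:R) ^+ 2 - (X * Y) ^+ 2| <= 4 * (X * Y ^+ 2).
  rewrite distrC ger0_norm; last first.
    by rewrite subr_ge0 ler_sqr ?nnegrE ?mulr_ge0// ler_pM.
  rewrite (_ : _ - _ = (X ^+ 2 - n%:R ^+ 2) * Y ^+ 2 + n%:R ^+ 2 * (Y ^+ 2 - m%:R ^+ 2)); last by ring.
  have a1 : X ^+ 2 - n%:R ^+ 2 <= 2 * X by nra.
  have a2 : Y ^+ 2 - m%:R ^+ 2 <= 2 * Y by nra.
  have a3 : n%:R ^+ 2 * (Y ^+ 2 - m%:R ^+ 2) <= X ^+ 2 * (2 * Y).
    apply: ler_pM => //; rewrite ?exprn_ge0//.
      by rewrite subr_ge0 ler_sqr ?nnegrE.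
    by rewrite ler_sqr ?nnegrE.
  have a4 : (X ^+ 2 - n%:R ^+ 2) * Y ^+ 2 <= 2 * X * Y ^+ 2.
    by rewrite ler_wpM2r ?exprn_ge0.
  have a5 : X ^+ 2 * Y <= X * Y ^+ 2.
    by rewrite !expr2 -mulrA ler_wpM2l// ler_wpM2r.
  lra.
rewrite (le_trans (ler_distD (c0 * (n%:R * m%:R) ^+ 2) _ _))//.
rewrite (le_trans (lerD h (lexx _)))// -mulrBr normrM.
have h3 : `|c0| * `|(n%:R * m%:R) ^+ 2 - (X * Y) ^+ 2| <= `|c0| * (4 * (X * Y ^+ 2) * (9 * L)).
  rewrite ler_wpM2l// (le_trans h2)// ler_peMr// mulr_ge0//.
rewrite (_ : X * Y ^+ 2 * _ * _ = X * Y ^+ 2 * L); last by rewrite /L; ring.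
have X2L : 0 <= X * Y ^+ 2 * L by rewrite mulr_ge0//; lra.
rewrite (_ : _ * (16 * L) = 16 * (X * Y ^+ 2 * L)) in h1; last by ring.
rewrite (_ : 4 * _ * (9 * L) = 36 * (X * Y ^+ 2 * L)) in h3; last by ring.
move: h1 h3 X2L; move: (n%:R * _ * _) (`|c0|) (`|_ - _|) (X * _ * L) => A u v Q; lra.
Qed.
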